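(* Consider the hybrid system $\dot x\in F(x)$, $x\in C$; $x^+\in G(x)$, $x\in D$, with $C,D\subseteq\mathbb{R}^n$, $F,G:\mathbb{R}^n\rightrightarrows\mathbb{R}^n$ satisfying the hybrid basic conditions (A1)–(A3) below, and a $t$-complete solution $\phi^\star$. Suppose: (i) $G(D)\cap D=\emptyset$, $G(D)\subseteq C$, and $G$ is single-valued and proper; (ii) $F(x)\cap T_C(x)=\emptyset$ for all $x\in C\cap D$; (iii) $-F(x)\cap T_C(x)=\emptyset$ for all $x\in C\cap G(D)$; (iv) either $D$ is bounded or $\phi^\star$ is bounded. If $\phi^\star$ is stable (respectively asymptotically stable) with respect to $\rho_{\mathcal A}$, then $\phi^\star$ is stable (respectively asymptotically stable) in graphical sense.
   Context: Notation: Euclidean norm $\|\cdot\|$, $\mathcal B_s=\{x:\|x\|\le s\}$, $\operatorname{dom}F=\{x:F(x)\ne\emptyset\}$. (A1) $C,D$ closed; (A2) $F$ outer semicontinuous and locally bounded relative to $C$, $C\subseteq\operatorname{dom}F$, $F(x)$ convex for $x\in C$; (A3) $G$ outer semicontinuous and locally bounded relative to $D$, $D\subseteq\operatorname{dom}G$. Solutions are defined on hybrid time domains $E\subseteq\mathbb{R}_{\ge0}\times\mathbb{N}$ (sets whose truncations are finite unions $\bigcup_j[t_j,t_{j+1}]\times\{j\}$, $0=t_0\le t_1\le\cdots$), with $t\mapsto\phi(t,j)$ locally absolutely continuous, $\phi(0,0)\in C\cup D$, flowing in $C$ with $\dot\phi\in F(\phi)$ a.e. on intervals of flow, and with $\phi(t,j)\in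 D$, $\phi(t,j+1)\in G(\phi(t,j))$ whenever $(t,j),(t,j+1)\in\operatorname{dom}\phi$. A solution is maximal if it cannot be extended, $t$-complete if $\sup_{(t,j)\in\operatorname{dom}\phi}t=\infty$, bounded if $\sup\|\phi(t,j)\|<\infty$. $T_C(x)$ is the Bouligand tangent cone; $G$ proper means preimages of compact sets are compact. $\mathcal A=\{(x_1,x_2)\in(C\cup D\cup G(D))^2: x_1=x_2, \text{ or } (x_2\in D\wedge x_1\in G(x_2)), \text{ or } (x_1\in D\wedge x_2\in G(x_1))\}$, $\rho_{\mathcal A}(x,y)=\inf_{(u,v)\in\mathcal A}\|(x-u,y-v)\|$. Stable with respect to $\rho_{\mathcal A}$: for every $\varepsilon_w>0$ there is $\delta_w>0$ such that every maximal solution $\phi$ with $\rho_{\mathcal A}(\phi^\star(0,0),\phi(0,0))<\delta_w$ satisfies (a) for all $(t,j)\in\operatorname{dom}\phi^\star$ there is $(t,j')\in\operatorname{dom}\phi$ with $\rho_{\mathcal A}(\phi^\star(t,j),\phi(t,j'))<\varepsilon_w$, and (b) for all $(t,j')\in\operatorname{dom}\phi$ there is $(t,j)\in\operatorname{dom}\phi^\star$ with $\rho_{\mathcal A}(\phi^\star(t,j),\phi(t,j'))<\varepsilon_w$. Asymptotically stable w.r.t. $\rho_{\mathcal A}$: in addition there is $r_w>0$ such that for every $\varepsilon_w>0$ and every maximal $\phi$ with $\rho_{\mathcal A}(\phi^\star(0,0),\phi(0,0))<r_w$ there is $T_w\ge0$ such that (a) holds for all $(t,j)\in\operatorname{dom}\phi^\star$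 with $t\ge T_w$ and (b) holds for all $(t,j')\in\operatorname{dom}\phi$ with $t\ge T_w$. Stable in graphical sense: for every $\varepsilon>0$ there is $\delta>0$ such that every maximal solution $\phi$ with $\|\phi^\star(0,0)-\phi(0,0)\|<\delta$ satisfies (c) for all $(t,j)\in\operatorname{dom}\phi^\star$ there is $(t',j')\in\operatorname{dom}\phi$ with $|t-t'|<\varepsilon$ and $\|\phi^\star(t,j)-\phi(t',j')\|<\varepsilon$, and (d) for all $(t',j')\in\operatorname{dom}\phi$ there is $(t,j)\in\operatorname{dom}\phi^\star$ with $|t-t'|<\varepsilon$ and $\|\phi^\star(t,j)-\phi(t',j')\|<\varepsilon$. Asymptotically stable in graphical sense: in addition there is $r>0$ such that for every $\varepsilon>0$ and every maximal $\phi$ with $\|\phi^\star(0,0)-\phi(0,0)\|<r$ there is $T\ge0$ such that (c) holds for all $(t,j)\in\operatorname{dom}\phi^\star$ with $t\ge T$ and (d) holds for all $(t',j')\in\operatorname{dom}\phi$ with $t'\ge T$. *)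

(* Defs.v *)
From HB Require Import structures.
From mathcomp Require Import all_boot all_order all_algebra.
From mathcomp Require Import all_classical all_reals all_analysis.
Set Implicit Arguments.
Unset Strict Implicit.
Unset Printing Implicit Defensive.
Import Order.TTheory GRing.Theory Num.Theory.
Import numFieldNormedType.Exports.
Local Open Scope classical_set_scope.
Local Open Scope ring_scope.

Section Hybrid.
Variables (R : realType) (n : nat).
Local Notation vec := 'rV[R]_n.

Definition enorm (x : vec) : R := Num.sqrt (\sum_(i < n) x 0 i ^+ 2).

Definition enorm2 (a b : vec) : R := Num.sqrt (enorm a ^+ 2 + enorm b ^+ 2).

Definition setmap := vec -> set vec.

Definition dom (F : setmap) : set vec := [set x | F x !=set0].

Definition simage (F : setmap) (S : set vec) : set vec :=
  [set y | exists2 x, S x & F x y].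

Definition ebounded_set (S : set vec) : Prop :=
  exists M : R, forall x, S x -> enorm x <= M.

Definition osc_rel (F : setmap) (C : set vec) : Prop :=
  forall (x y : vec) (xs ys : nat -> vec),
    C x -> (forall i, C (xs i)) -> (forall i, F (xs i) (ys i)) ->
    xs @ \oo --> x -> ys @ \oo --> y -> F x y.

Definition locbdd_rel (F : setmap) (C : set vec) : Prop :=
  forall x, C x -> exists2 r : R, 0 < r & exists M : R,
    forall z y, C z -> enorm (z - x) < r -> F z y -> enorm y <= M.

Definition hconvex_set (S : set vec) : Prop :=
  forall a b (l : R), S a -> S b -> 0 <= l <= 1 -> S (l *: a + (1 - l) *: b).

Definition tangent_cone (C : set vec) (x : vec) : set vec :=
  [set w | exists (ts : nat -> R) (ws : nat -> vec),
     (forall i, 0 < ts i) /\ ts @ \oo --> (0 : R) /\ ws @ \oo --> w /\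
     (forall i, C (x + ts i *: ws i))].

Definition preimage_sm (G : setmap) (K : set vec) : set vec :=
  [set x | exists2 y, G x y & K y].
Definition proper_map (G : setmap) : Prop :=
  forall K : set vec, compact K -> compact (preimage_sm G K).

Definition single_valued (G : setmap) : Prop :=
  forall x, dom G x -> exists y, G x = [set y].

Definition hybrid_time_domain (E : set (R * nat)) : Prop :=
  (forall s k, E (s, k) -> 0 <= s) /\
  forall T J, E (T, J) ->
    exists (J' : nat) (t : nat -> R),
      t 0%N = 0 /\ (forall j, t j <= t j.+1) /\
      forall s k, (E (s, k) /\ s <= T /\ (k <= J)%N) <->
                  ((k <= J')%N /\ t k <= s /\ s <= t k.+1).

Definition abs_cont_on (a b : R) (f : R -> vec) : Prop :=
  forall e : R, 0 < e -> exists2 d : R, 0 < d &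
    forall (m : nat) (xa xb : nat -> R),
      (forall k, (k < m)%N -> a <= xa k /\ xa k <= xb k /\ xb k <= b) ->
      (forall k l, (k < l)%N -> (l < m)%N -> xb k <= xa l) ->
      \sum_(k < m) (xb k - xa k) < d ->
      \sum_(k < m) enorm (f (xb k) - f (xa k)) < e.

Definition loc_abs_cont (I : set R) (f : R -> vec) : Prop :=
  forall a b, a <= b -> `[a, b] `<=` I -> abs_cont_on a b f.

Definition Ij (E : set (R * nat)) (j : nat) : set R := [set t | E (t, j)].
Definition int_Ij (E : set (R * nat)) (j : nat) : set R :=
  [set t | exists s1 s2, s1 < t /\ t < s2 /\ E (s1, j) /\ E (s2, j)].

(* a solution (E, phi) to the hybrid system (C,F,D,G); phi is only
   meaningful on its hybrid time domain E *)
Definition is_solution (C : set vec) (F : setmap) (D : set vec) (G : setmap)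
    (E : set (R * nat)) (phi : R -> nat -> vec) : Prop :=
  [/\ hybrid_time_domain E /\ E (0, 0%N),
      C (phi 0 0%N) \/ D (phi 0 0%N),
      (forall j, loc_abs_cont (Ij E j) (fun t => phi t j)),
      (forall j, int_Ij E j !=set0 ->
         (forall t, int_Ij E j t -> C (phi t j)) /\
         {ae @lebesgue_measure R, forall t, Ij E j t ->
            derivable (fun s => phi s j) t 1 /\
            F (phi t j) ('D_1 (fun s => phi s j) t)}) &
      (forall t j, E (t, j) -> E (t, j.+1) ->
         D (phi t j) /\ G (phi t j) (phi t j.+1))].

Definition is_maximal_solution C F D G E phi : Prop :=
  is_solution C F D G E phi /\
  ~ (exists (E' : set (R * nat)) (psi : R -> nat -> vec),
       is_solution C F D G E' psi /\ E `<=` E' /\ E <> E' /\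
       (forall t j, E (t, j) -> psi t j = phi t j)).

Definition t_complete (E : set (R * nat)) : Prop :=
  forall T : R, exists t j, E (t, j) /\ T <= t.

Definition bounded_sol (E : set (R * nat)) (phi : R -> nat -> vec) : Prop :=
  exists M : R, forall t j, E (t, j) -> enorm (phi t j) <= M.

Definition setA (C D : set vec) (G : setmap) : set (vec * vec) :=
  [set p | let S := C `|` D `|` simage G D in
     S p.1 /\ S p.2 /\
     (p.1 = p.2 \/ (D p.2 /\ G p.2 p.1) \/ (D p.1 /\ G p.1 p.2))].

Definition rhoA (C D : set vec) (G : setmap) (x y : vec) : R :=
  inf [set enorm2 (x - p.1) (y - p.2) | p in setA C D G].

Definition stable_rho C F D G Es phis : Prop :=
  forall ew : R, 0 < ew -> exists2 dw : R, 0 < dw &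
    forall E phi, is_maximal_solution C F D G E phi ->
      rhoA C D G (phis 0 0%N) (phi 0 0%N) < dw ->
      (forall t j, Es (t, j) -> exists j',
          E (t, j') /\ rhoA C D G (phis t j) (phi t j') < ew) /\
      (forall t j', E (t, j') -> exists j,
          Es (t, j) /\ rhoA C D G (phis t j) (phi t j') < ew).

Definition as_stable_rho C F D G Es phis : Prop :=
  stable_rho C F D G Es phis /\
  exists2 rw : R, 0 < rw &
    forall ew : R, 0 < ew ->
    forall E phi, is_maximal_solution C F D G E phi ->
      rhoA C D G (phis 0 0%N) (phi 0 0%N) < rw ->
      exists Tw : R, 0 <= Tw /\
      (forall t j, Es (t, j) -> Tw <= t -> exists j',
          E (t, j') /\ rhoA C D G (phis t j) (phi t j') < ew) /\
      (forall t j', E (t, j') -> Tw <= t -> exists j,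
          Es (t, j) /\ rhoA C D G (phis t j) (phi t j') < ew).

Definition stable_graph C F D G Es phis : Prop :=
  forall e : R, 0 < e -> exists2 d : R, 0 < d &
    forall E phi, is_maximal_solution C F D G E phi ->
      enorm (phis 0 0%N - phi 0 0%N) < d ->
      (forall t j, Es (t, j) -> exists t' j',
          E (t', j') /\ `|t - t'| < e /\ enorm (phis t j - phi t' j') < e) /\
      (forall t' j', E (t', j') -> exists t j,
          Es (t, j) /\ `|t - t'| < e /\ enorm (phis t j - phi t' j') < e).

Definition as_stable_graph C F D G Es phis : Prop :=
  stable_graph C F D G Es phis /\
  exists2 r : R, 0 < r &
    forall e : R, 0 < e ->
    forall E phi, is_maximal_solution C F D G E phi ->
      enorm (phis 0 0%N - phi 0 0%N) < r ->
      exists T : R, 0 <= T /\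
      (forall t j, Es (t, j) -> T <= t -> exists t' j',
          E (t', j') /\ `|t - t'| < e /\ enorm (phis t j - phi t' j') < e) /\
      (forall t' j', E (t', j') -> T <= t' -> exists t j,
          Es (t, j) /\ `|t - t'| < e /\ enorm (phis t j - phi t' j') < e).

End Hybrid.

(* Main.v *)
Require Import Defs.
From HB Require Import structures.
From mathcomp Require Import all_boot all_order all_algebra.
From mathcomp Require Import all_classical all_reals all_analysis.
From mathcomp Require Import ring lra zify.
Import Order.TTheory GRing.Theory Num.Theory.
Import numFieldNormedType.Exports.
Local Open Scope classical_set_scope.
Local Open Scope ring_scope.

(* Near a pair (u, G u) with u in D, smallness of rhoA does not give closeness of
   the values, but the two solutions differ there only by a short time shift.
   By (ii), a solution in C close to a compact part of D cannot flow for long: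
   a long flow x from x(0) close to k has (x(h) - k) / h close to F k for small h
   (F k being convex and F outer semicontinuous), which would produce a tangent
   vector of C at k in F k.  Hence it jumps soon, to a point close to G u.  By
   (iii), similarly, a solution close to G u has just jumped.  Properness of G and
   (iv) confine the relevant points u to a compact part of D, which makes these
   estimates uniform. *)

(** The obstacle is that the two directions are not symmetric. A solution near [u] has its future
    determined up to small errors, because [G] is continuous on [D]. A solution near [G u] has just
    jumped, but possibly from another preimage of a point near [G u], so its present value says
    nothing about its earlier one. What helps is that [rhoA] is small at every time of a short
    window before [t], not only at [t]. Just before the jump the off-diagonal alternatives are
    impossible, since the compact part of [D] has positive distance from [G(D)] and its image has
    positive distance from [D]; only ordinary closeness remains. The window has a price: a delay in
    the asymptotic statement, and the use of the initial values when the window would reach below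
    time 0. *)

Section EuclideanNorm.
Context {R : realType} {n : nat}.
Implicit Types (x y z : 'rV[R]_n) (a : R).

(** * Inner product, Euclidean norm and sequential compactness *)

Definition dot x y : R := \sum_(i < n) x 0 i * y 0 i.

Lemma dotC x y : dot x y = dot y x.
Proof. by apply: eq_bigr => i _; rewrite mulrC. Qed.

Lemma dotDl x y z : dot (x + y) z = dot x z + dot y z.
Proof. by rewrite -big_split; apply: eq_bigr => i _; rewrite mxE mulrDl. Qed.

Lemma dotZl a x y : dot (a *: x) y = a * dot x y.
Proof. by rewrite mulr_sumr; apply: eq_bigr => i _; rewrite mxE mulrA. Qed.

Lemma dotBl x y z : dot (x - y) z = dot x z - dot y z.
Proof. by rewrite dotDl -scaleN1r dotZl mulN1r. Qed.

Lemma dotBr x y z : dot x (y - z) = dot x y - dot x z.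
Proof. by rewrite dotC dotBl !(dotC x). Qed.

Lemma dotDr x y z : dot x (y + z) = dot x y + dot x z.
Proof. by rewrite dotC dotDl !(dotC x). Qed.

Lemma dotZr a x y : dot x (a *: y) = a * dot x y.
Proof. by rewrite dotC dotZl dotC. Qed.

Lemma enorm_sqr x : enorm x ^+ 2 = dot x x.
Proof.
rewrite sqr_sqrtr; first by apply: eq_bigr => i _; rewrite expr2.
by apply: sumr_ge0 => i _; rewrite sqr_ge0.
Qed.

Lemma enorm_ge0 x : 0 <= enorm x.
Proof. exact: sqrtr_ge0. Qed.

Lemma norm_coord_le_enorm x i : `|x 0 i| <= enorm x.
Proof.
rewrite -sqrtr_sqr ler_wsqrtr // (bigD1 i) //= lerDl.
by apply: sumr_ge0 => j _; rewrite sqr_ge0.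
Qed.

Lemma enorm_eq0 x : enorm x = 0 -> x = 0.
Proof.
move=> x0; apply/rowP => i; rewrite mxE; apply/eqP.
by rewrite -normr_eq0 eq_le normr_ge0 andbT -x0 norm_coord_le_enorm.
Qed.

Lemma enorm0 : enorm (0 : 'rV[R]_n) = 0.
Proof.
by rewrite /enorm big1 ?sqrtr0 // => i _; rewrite mxE expr0n.
Qed.

Lemma enormZ a x : enorm (a *: x) = `|a| * enorm x.
Proof.
rewrite /enorm -sqrtr_sqr -sqrtrM ?sqr_ge0 //; congr Num.sqrt.
by rewrite mulr_sumr; apply: eq_bigr => i _; rewrite mxE exprMn.
Qed.

Lemma enormN x : enorm (- x) = enorm x.
Proof. by rewrite -scaleN1r enormZ normrN1 mul1r. Qed.

Definition edist x y : R := enorm (x - y).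

Lemma edist_ge0 x y : 0 <= edist x y.
Proof. exact: enorm_ge0. Qed.

Lemma edistxx x : edist x x = 0.
Proof. by rewrite /edist subrr enorm0. Qed.

Lemma edistC x y : edist x y = edist y x.
Proof. by rewrite /edist -enormN opprB. Qed.

Lemma dot_le_enorm x y : dot x y <= enorm x * enorm y.
Proof.
have [x0|xn0] := eqVneq (enorm x) 0.
  by rewrite (enorm_eq0 x x0) enorm0 mul0r /dot big1 // => i _; rewrite mxE mul0r.
have [y0|yn0] := eqVneq (enorm y) 0.
  by rewrite (enorm_eq0 y y0) enorm0 mulr0 /dot big1 // => i _; rewrite mxE mulr0.
have x0 : 0 < enorm x by rewrite lt_neqAle eq_sym xn0 enorm_ge0.
have y0 : 0 < enorm y by rewrite lt_neqAle eq_sym yn0 enorm_ge0.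
have := sqr_ge0 (enorm (enorm y *: x - enorm x *: y)).
rewrite enorm_sqr !(dotBl, dotBr, dotZl, dotZr) -!enorm_sqr (dotC y x).
move=> h; rewrite -subr_ge0 -(@pmulr_rge0 _ (2 * (enorm x * enorm y))).
  by apply: le_trans h _; rewrite le_eqVlt; apply/orP; left; apply/eqP; ring.
by rewrite !mulr_gt0.
Qed.

Lemma norm_dot_le x y : `|dot x y| <= enorm x * enorm y.
Proof.
rewrite ler_norml dot_le_enorm andbT lerNl -(enormN x) -mulN1r -dotZl scaleN1r.
exact: dot_le_enorm.
Qed.

Lemma enormD x y : enorm (x + y) <= enorm x + enorm y.
Proof.
rewrite -(@ler_pXn2r _ 2) ?nnegrE ?addr_ge0 ?enorm_ge0 //.
rewrite enorm_sqr dotDl !dotDr -!enorm_sqr (dotC y x).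
have := dot_le_enorm x y; lra.
Qed.

Lemma edist_triangle y x z : edist x z <= edist x y + edist y z.
Proof. by rewrite /edist -[x - z](subrKA y); exact: enormD. Qed.

Lemma enorm_le_dist x y : enorm x <= enorm y + edist x y.
Proof. by rewrite -{1}[x](subrKC y) enormD. Qed.

Lemma normr_le_enorm x : `|x| <= enorm x.
Proof.
rewrite [`|x|]mx_normrE; apply/bigmax_leP; split; first exact: enorm_ge0.
by move=> [i j] _ /=; rewrite ord1 norm_coord_le_enorm.
Qed.

Lemma enorm_le_normr x : enorm x <= n%:R * `|x|.
Proof.
rewrite -(@ler_pXn2r _ 2) ?nnegrE ?enorm_ge0 ?mulr_ge0 //.
rewrite enorm_sqr exprMn.
have h : dot x x <= n%:R * `|x| ^+ 2.
  rewrite mulr_natl -[X in _ *+ X]card_ord -sumr_const; apply: ler_sum => i _.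
  rewrite -expr2 -real_normK ?num_real // ler_pXn2r ?nnegrE //.
  rewrite [`|x|]mx_normrE.
  exact: (@le_bigmax_cond _ _ _ 0 (ord0, i) xpredT
    (fun ij : 'I_1 * 'I_n => `|x ij.1 ij.2|)).
apply: le_trans h _; rewrite ler_wpM2r ?sqr_ge0 // -natrX ler_nat.
by case: (n) => // m; nia.
Qed.

Lemma enorm_cvg (xs : nat -> 'rV[R]_n) x :
  (forall e : R, 0 < e -> exists N, forall i, (N <= i)%N -> edist (xs i) x < e) ->
  xs @ \oo --> x.
Proof.
move=> h; apply/cvgrPdist_lt => e e0; have [N hN] := h e e0.
exists N => // i /= /hN; apply: le_lt_trans.
by rewrite distrC normr_le_enorm.
Qed.

Lemma natSinv_lt (e : R) : 0 < e -> exists N, forall i, (N <= i)%N -> i.+1%:R^-1 < e.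
Proof.
by move=> e0; have [N _ h] := near_infty_natSinv_lt (PosNum e0); exists N.
Qed.

Lemma enorm_cvg_inv (xs : nat -> 'rV[R]_n) x :
  (forall i, edist (xs i) x < i.+1%:R^-1) -> xs @ \oo --> x.
Proof.
move=> h; apply: enorm_cvg => e /natSinv_lt[N hN]; exists N => i /hN.
exact: lt_trans.
Qed.

Lemma closed_eball (C : set 'rV[R]_n) x : closed C -> ~ C x ->
  exists2 e : R, 0 < e & forall y, edist y x < e -> ~ C y.
Proof.
move=> cC nCx; apply: contrapT => h; apply: nCx.
have {}h i : exists y, edist y x < i.+1%:R^-1 /\ C y.
  apply: contrapT => h'; apply: h; exists i.+1%:R^-1 => // y yx Cy.
  by apply: h'; exists y.
case: (choice h) => ys hys.
apply: (closed_cvg C cC _ x (enorm_cvg_inv ys x (fun i => (hys i).1))).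
by exists 0%N => // i _; exact: (hys i).2.
Qed.

Lemma ebounded_subseq (M : R) (xs : nat -> 'rV[R]_n) :
  (forall i, enorm (xs i) <= M) ->
  exists (x : 'rV[R]_n) (s : nat -> nat), (forall i, (i <= s i)%N) /\
    forall i, edist (xs (s i)) x < i.+1%:R^-1.
Proof.
move=> xM.
have cB : compact (closed_ball (0 : 'rV[R]_n) (`|M| + 1)).
  have r0 : 0 < `|M| + 1 by rewrite ltr_wpDl.
  apply: bounded_closed_compact; last exact: closed_ball_closed.
  exists (`|M| + 1); split; first exact: num_real.
  move=> r rM y; rewrite closed_ballE //= /closed_ball_ /= sub0r normrN => h.
  exact: le_trans h (ltW rM).
have [|x [_ xcl]] := cB (xs @ \oo) _.
  exists 0%N => // i _ /=.
  rewrite closed_ballE ?ltr_wpDl //= /closed_ball_ /= sub0r normrN.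
  apply: (le_trans (normr_le_enorm _)); apply: (le_trans (xM i)).
  by rewrite (le_trans (ler_norm M)) // lerDl.
exists x.
suff h i : exists k, (i <= k)%N /\ edist (xs k) x < i.+1%:R^-1.
  by case: (choice h) => s hs; exists s; split => i; have [] := hs i.
(* The cluster point refers to the sup norm, and [enorm] is at most [n] times that norm; [n.+1] also
   covers dimension 0. *)
have e0 : 0 < i.+1%:R^-1 / n.+1%:R :> R by rewrite divr_gt0.
have [|y [[k ik /= yk]]] := xcl [set xs k | k in [set k | (i <= k)%N]]
   (ball x (i.+1%:R^-1 / n.+1%:R)) _ (nbhsx_ballx _ _ e0).
  by exists i => // k ik; exists k.
rewrite -yk mx_norm_ball /= /ball_ /= distrC => h; exists k; split => //.
apply: le_lt_trans (enorm_le_normr _) _.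
apply: (@le_lt_trans _ _ (n.+1%:R * `|xs k - x|)); first by rewrite ler_wpM2r // ler_nat.
by rewrite mulrC -ltr_pdivlMr.
Qed.

(** The index map is only asked to satisfy [i <= s i]; together with the explicit rate this suffices
    to carry other bounds of order [1 / (i + 1)] along the extraction. *)
Definition seq_compact (K : set 'rV[R]_n) : Prop :=
  forall us : nat -> 'rV[R]_n, (forall i, K (us i)) ->
  exists u (s : nat -> nat), [/\ K u, forall i, (i <= s i)%N &
    forall i, edist (us (s i)) u < i.+1%:R^-1].

Lemma closed_seq_compact (C : set 'rV[R]_n) (M : R) :
  closed C -> seq_compact (C `&` [set x | enorm x <= M]).
Proof.
move=> cC us hus.
have [u [s [si hs]]] := ebounded_subseq M us (fun i => (hus i).2).
exists u, s; split => //; split.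
  apply: (closed_cvg C cC _ u (enorm_cvg_inv _ u hs)).
  by exists 0%N => // i _; exact: (hus _).1.
apply/ler_addgt0Pr => e /natSinv_lt[N /(_ N (leqnn N)) Ne].
apply: le_trans (enorm_le_dist u (us (s N))) _.
by rewrite lerD ?(hus _).2 // edistC ltW // (lt_trans (hs N)).
Qed.

(** Points failing at scale [1 / (i + 1)] accumulate at some [k] in [K]. The radius valid around [k]
    eventually exceeds both the scale and the distance to [k], and monotonicity brings it down to
    the scale. *)
Lemma seq_compact_uniform (K : set 'rV[R]_n) (Q : 'rV[R]_n -> R -> Prop) :
  seq_compact K ->
  (forall k e e', 0 < e' -> e' <= e -> Q k e -> Q k e') ->
  (forall k, K k -> exists2 e, 0 < e &
     forall k', K k' -> edist k' k < e -> Q k' e) ->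
  exists2 e, 0 < e & forall k, K k -> Q k e.
Proof.
move=> cK Qmono Qloc; apply: contrapT => h.
have {}h i : exists k, K k /\ ~ Q k i.+1%:R^-1.
  apply: contrapT => h'; apply: h; exists i.+1%:R^-1 => // k Kk.
  by apply: contrapT => nQ; apply: h'; exists k.
case: (choice h) => ks hks.
have [k [s [Kk si ki]]] := cK ks (fun i => (hks i).1).
have [e e0 Qe] := Qloc k Kk; have [N /(_ N (leqnn N)) Ne] := natSinv_lt e e0.
have [Ks nQ] := hks (s N); apply: nQ.
apply: (Qmono _ e) => //; last by apply: Qe => //; exact: lt_trans (ki N) Ne.
apply: le_trans (ltW Ne); rewrite lef_pV2 ?posrE ?ltr0n // ler_nat ltnS.
exact: si.
Qed.

End EuclideanNorm.

(** * A mean value inequality for absolutely continuous arcs, without integrals *)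

Section AbsolutelyContinuous.
Context {R : realType} {n : nat}.

(** A step straddling the supremum of the good points, started just below it, lands beyond it unless
    [b] is already within reach. This replaces the extraction of a finite tagged partition. *)
Lemma cousin_induction (a b : R) (P : R -> Prop) :
  a <= b -> P a ->
  (forall s, a <= s -> s <= b -> exists2 d, 0 < d & forall u v,
     a <= u -> u <= s -> s <= v -> v <= b -> s - u < d -> v - s < d ->
     P u -> P v) ->
  P b.
Proof.
move=> ab Pa step; pose S := [set u | [/\ a <= u, u <= b & P u]].
have supS : has_sup S by split; [exists a | exists b => u []].
have aS : a <= sup S by apply: (sup_upper_bound supS).
have Sb : sup S <= b by apply: sup_le_ub; [exists a | move=> u []].
have [d d0 hd] := step _ aS Sb.
have [u [au ub Pu] du] := sup_adherent d0 supS.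
have uS : u <= sup S by apply: (sup_upper_bound supS).
have [vb|bv] := leP (sup S + d / 2) b.
  have Pv : P (sup S + d / 2) by apply: (hd u) => //; lra.
  have : sup S + d / 2 <= sup S by apply: (sup_upper_bound supS); split => //; lra.
  by lra.
by apply: (hd u) => //; lra.
Qed.

(** The interval has to contain [t], as in a tagged partition: a derivative at [t] controls such
    increments, but not increments over intervals merely close to [t]. *)
Definition slope_le (a b : R) (f : R -> 'rV[R]_n) e (c t : R) : Prop :=
  forall h : R, 0 < h -> exists2 d, 0 < d & forall u v,
    a <= u -> u <= t -> t <= v -> v <= b -> t - u < d -> v - t < d ->
    dot (f v - f u) e <= (c + h) * (v - u).

(* Partition [a, b] finely, tagging with points where the slope bound holds or
   with points of the exceptional null set; the intervals of the second kind
   lie in an open set of small measure, so absolute continuity makes their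
   contribution small. *)
Lemma abs_cont_dot_le (a b : R) (f : R -> 'rV[R]_n) e c :
  a <= b -> abs_cont_on a b f ->
  {ae @lebesgue_measure R, forall t, a <= t <= b -> slope_le a b f e c t} ->
  dot (f b - f a) e <= c * (b - a).
Proof.
move=> ab acf [A [mA /= A0 NA]]; have {A0} muA : lebesgue_measure A = 0%E := A0.
apply/ler_addgt0Pr => eps eps0.
(* The error [eps] is split in three: the slack [h] in the slopes, the variation of [f] over the
   exceptional intervals, and [c] times their length. The added 1 avoids dividing by 0 here and in
   the two similar constants below. *)
pose h := eps / (3 * (b - a + 1)).
have h0 : 0 < h by rewrite divr_gt0 // mulr_gt0 //; lra.
have hb : h * (b - a) <= eps / 3.
  have : h * (3 * (b - a + 1)) = eps by rewrite divfK // lt0r_neq0 //; lra.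
  by lra.
have e0 := enorm_ge0 e.
have [d1 d10 ac1] : exists2 d, 0 < d & forall (m : nat) (xa xb : nat -> R),
   (forall k, (k < m)%N -> a <= xa k /\ xa k <= xb k /\ xb k <= b) ->
   (forall k l, (k < l)%N -> (l < m)%N -> xb k <= xa l) ->
   \sum_(k < m) (xb k - xa k) < d ->
   (\sum_(k < m) enorm (f (xb k) - f (xa k))) * enorm e <= eps / 3.
  have q0 : 0 < eps / (3 * (enorm e + 1)) by rewrite divr_gt0 // mulr_gt0 //; lra.
  have [d d0 hd] := acf _ q0; exists d => // m xa xb h1 h2 h3.
  have := ltW (hd m xa xb h1 h2 h3).
  rewrite ler_pdivlMr; last by rewrite mulr_gt0 //; lra.
  set S := \sum_(k < m) _; have : 0 <= S by apply: sumr_ge0 => *; exact: enorm_ge0.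
  by nra.
pose d := Num.min d1 (eps / (3 * (`|c| + 1))).
have c0 := normr_ge0 c.
have d0 : 0 < d by rewrite lt_min d10 divr_gt0 // mulr_gt0 //; lra.
have dc : `|c| * d <= eps / 3.
  have : d <= eps / (3 * (`|c| + 1)) by rewrite ge_min lexx orbT.
  by rewrite ler_pdivlMr; [nra | rewrite mulr_gt0 //; lra].
have fA : (lebesgue_measure A < +oo)%E by rewrite muA.
have [U [oU AU muU]] := lebesgue_regularity_outer mA fA d0.
have mU : measurable U by exact: measurable_realfun.open_measurable.
have {}muU : (lebesgue_measure U < d%:E)%E.
  have mUA : measurable (U `\` A) by exact: measurableD.
  have AUA : A `&` (U `\` A) = set0 by rewrite setDIK.
  have -> : lebesgue_measure U =
      (lebesgue_measure A + lebesgue_measure (U `\` A))%E.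
    by rewrite -[in LHS](setDUK AU); exact: measureU.
  by rewrite muA add0e.
(* [xa] and [xb] list the intervals tagged so far by points of [A]. Each is chosen inside [U],
   whence the measure bound. Their length is also counted in [u - a], where [c + h] may be negative;
   the last term compensates for this. *)
pose P u := exists (m : nat) (xa xb : nat -> R),
  [/\ forall k, (k < m)%N -> a <= xa k /\ xa k <= xb k /\ xb k <= u,
      forall k l, (k < l)%N -> (l < m)%N -> xb k <= xa l,
      ((\sum_(k < m) (xb k - xa k))%:E <= lebesgue_measure (U `&` `[a, u[))%E &
      dot (f u - f a) e <= (c + h) * (u - a) +
        (\sum_(k < m) enorm (f (xb k) - f (xa k))) * enorm e +
        `|c| * \sum_(k < m) (xb k - xa k)].
have mUI u : measurable (U `&` `[a, u[) by apply: measurableI.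
have Pa : P a.
  exists 0%N, (fun=> 0), (fun=> 0); split => //; first by rewrite big_ord0.
  by rewrite !big_ord0 !subrr !mulr0 mul0r !addr0 -(subrr 0) dotBl subrr.
have dotS u v : dot (f v - f a) e = dot (f u - f a) e + dot (f v - f u) e.
  by rewrite !dotBl; lra.
have : P b.
  apply: (cousin_induction a b) => // s as_ sb.
  have [As|nAs] := pselect (A s).
    have [r /= r0 rU] := (nbhs_ballP _ _).1 (oU s (AU s As)).
    exists r => // u v au us sv vb ur vr [m [xa [xb [h1 h2 h3 h4]]]].
    pose xa' k := if (k < m)%N then xa k else u.
    pose xb' k := if (k < m)%N then xb k else v.
    have recr (G : R -> R -> R) :
        \sum_(k < m.+1) G (xb' k) (xa' k) = \sum_(k < m) G (xb k) (xa k) + G v u.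
      rewrite big_ord_recr /= /xa' /xb' ltnn; congr (_ + _).
      by apply: eq_bigr => k _; rewrite ltn_ord.
    exists m.+1, xa', xb'; split.
    - move=> k; rewrite /xa' /xb' ltnS leq_eqVlt; case: ltnP => [km _|_ _]; last by lra.
      by have [? [? ?]] := h1 k km; split => //; split => //; lra.
    - move=> k l kl; rewrite ltnS /xa' /xb' => lm; rewrite (leq_trans kl lm).
      case: ltnP => lm'; first exact: h2.
      by have [? [? ?]] := h1 k (leq_trans kl lm).
    - rewrite (recr (fun x y => x - y)) EFinD.
      apply: (@le_trans _ _ (lebesgue_measure ((U `&` `[a, u[) `|` `[u, v[)))%E.
        have -> : lebesgue_measure ((U `&` `[a, u[) `|` `[u, v[) =
            (lebesgue_measure (U `&` `[a, u[) + lebesgue_measure (`[u, v[ : set R))%E.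
          apply: measureU; [exact: mUI | exact: measurable_itv | ].
          rewrite predeqE => z; split => //= -[[_]].
          by rewrite !in_itv /=; lra.
        apply: leeD => //; rewrite lebesgue_measure_itv /= lte_fin.
        by case: ifPn => // /negP uv; rewrite lee_fin; lra.
      apply: le_measure; rewrite ?inE; [ | exact: mUI | ].
        by apply: measurableU; [exact: mUI | exact: measurable_itv].
      move=> z [[Uz]|]; rewrite /= !in_itv /= => hz; split => //; try lra.
      apply: rU; rewrite /= /ball /=; rewrite ltr_norml; lra.
    - rewrite (recr (fun x y => x - y)) (recr (fun x y => enorm (f x - f y))).
      rewrite (dotS u) mulrDl mulrDr.
      have D := dot_le_enorm (f v - f u) e.
      have hvu : 0 <= h * (v - u) by apply: mulr_ge0; lra.
      have cvu : 0 <= (`|c| + c) * (v - u).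
        apply: mulr_ge0; last lra.
        by have := ler_norm (- c); rewrite normrN; lra.
      by lra.
  have [|dl dl0 hdl] := contrapT (fun nsl => nAs (NA s nsl)) _ h h0; first by rewrite as_.
  exists dl => // u v au us sv vb ur vr [m [xa [xb [h1 h2 h3 h4]]]].
  exists m, xa, xb; split => //.
  - by move=> k /h1 [? [? ?]]; split => //; split => //; lra.
  - apply: le_trans h3 _; apply: le_measure; rewrite ?inE.
    + exact: mUI.
    + exact: mUI.
    move=> z [Uz] /=.
    by rewrite !in_itv /= => hz; split => //; lra.
  - by have := hdl u v au us sv vb ur vr; rewrite (dotS u); lra.
case=> m [xa [xb [h1 h2 h3 h4]]].
have Sd : \sum_(k < m) (xb k - xa k) < d.
  rewrite -lte_fin; apply: le_lt_trans h3 _; apply: le_lt_trans muU.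
  by apply: le_measure; rewrite ?inE; [exact: mUI | exact: mU | ] => z [].
have Sd1 : \sum_(k < m) (xb k - xa k) < d1 by rewrite (lt_le_trans Sd) // ge_min lexx.
have := ac1 m xa xb h1 h2 Sd1.
have : `|c| * \sum_(k < m) (xb k - xa k) <= eps / 3.
  by apply: le_trans dc; rewrite ler_wpM2l // ltW.
lra.
Qed.

End AbsolutelyContinuous.

(** * Semicontinuity, projection on convex sets and tangent vectors *)

Section SetValuedMaps.
Context {R : realType} {n : nat}.
Implicit Types (C V : set 'rV[R]_n) (F : setmap R n) (k : 'rV[R]_n).

Lemma osc_seq_compact C F k :
  osc_rel F C -> locbdd_rel F C -> C k -> seq_compact (F k).
Proof.
move=> oF bF Ck us Fus; have [r r0 [M hM]] := bF k Ck.
have usM i : enorm (us i) <= M.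
  by apply: (hM k) => //; rewrite subrr enorm0.
have [u [s [si hs]]] := ebounded_subseq M us usM.
exists u, s; split => //.
apply: (oF k u (fun=> k) (us \o s)) => //; first by move=> i; exact: Fus.
  exact: cvg_cst.
exact: enorm_cvg_inv.
Qed.

(** Local boundedness upgrades outer semicontinuity to upper semicontinuity: the values in a
    sequence of counterexamples stay bounded, so they accumulate at a point of [F k]. *)
Lemma osc_near C F k (h : R) :
  osc_rel F C -> locbdd_rel F C -> C k -> 0 < h ->
  exists2 r, 0 < r & forall z y, C z -> edist z k < r -> F z y ->
    exists2 v, F k v & edist y v < h.
Proof.
move=> oF bF Ck h0; have [r r0 [M hM]] := bF k Ck.
apply: contrapT => nh.
have {}nh i : exists p : 'rV[R]_n * 'rV[R]_n,
    [/\ C p.1, edist p.1 k < Num.min r i.+1%:R^-1, F p.1 p.2 &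
      forall v, F k v -> ~ edist p.2 v < h].
  apply: contrapT => nex; apply: nh; exists (Num.min r i.+1%:R^-1).
    by rewrite lt_min r0 /= invr_gt0.
  move=> z y Cz zk Fzy; apply: contrapT => nv; apply: nex; exists (z, y).
  by split => // v Fv yv; apply: nv; exists v.
case: (choice nh) => ps hps.
have psM i : enorm (ps i).2 <= M.
  by have [Cz + Fy _] := hps i; rewrite lt_min => /andP[zr _]; exact: hM Fy.
have [u [s [si hs]]] := ebounded_subseq M (fun i => (ps i).2) psM.
have Fku : F k u.
  apply: (oF k u (fun i => (ps (s i)).1) (fun i => (ps (s i)).2)) => //.
  - by move=> i; have [] := hps (s i).
  - by move=> i; have [] := hps (s i).
  - apply: enorm_cvg_inv => i; have [_ + _ _] := hps (s i).
    rewrite lt_min => /andP[_ /lt_le_trans]; apply.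
    by rewrite lef_pV2 ?posrE ?ltr0n // ler_nat ltnS.
  - exact: enorm_cvg_inv.
have [N /(_ N (leqnn N)) Nh] := natSinv_lt h h0.
have [_ _ _ /(_ u Fku)] := hps (s N); apply.
exact: lt_trans (hs N) Nh.
Qed.

Lemma seq_compact_opp V : seq_compact V -> seq_compact [set - v | v in V].
Proof.
move=> cV us hus.
have [|u [s [Vu si hs]]] := cV (fun i => - us i) _.
  by move=> i; have [v Vv <-] := hus i; rewrite opprK.
exists (- u), s; split => //; first by exists u.
by move=> i; have := hs i; rewrite edistC /edist !opprK addrC.
Qed.

Lemma seq_compact_projection V w : seq_compact V -> V !=set0 ->
  exists2 p, V p & forall v, V v -> edist w p <= edist w v.
Proof.
move=> cV [v0 Vv0]; pose S := [set edist w v | v in V].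
have infS : has_inf S.
  split; first by exists (edist w v0), v0.
  by exists 0 => _ [v _ <-]; exact: edist_ge0.
have h i : exists v, V v /\ edist w v < inf S + i.+1%:R^-1.
  have [|_ [v Vv <-] lt] := @inf_adherent _ S i.+1%:R^-1 _ infS; first by rewrite invr_gt0.
  by exists v.
case: (choice h) => vs hvs.
have [p [s [Vp si hs]]] := cV vs (fun i => (hvs i).1).
exists p => // v Vv; apply/ler_addgt0Pr => e e0.
have [|N hN] := natSinv_lt (e / 2); first lra.
have := edist_triangle (vs (s N)) w p.
have := lt_trans (hs N) (hN N (leqnn N)).
have : edist w (vs (s N)) < inf S + e / 2.
  by apply: lt_trans (hvs (s N)).2 _; rewrite ltrD2l hN.
have : inf S <= edist w v by apply: (ge_inf infS.2); exists v.
lra.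
Qed.

Lemma projection_dot_le V w p v : hconvex_set V -> V p -> V v ->
  (forall v', V v' -> edist w p <= edist w v') ->
  dot (v - p) (w - p) <= 0.
Proof.
move=> cV Vp Vv hp; rewrite leNgt; apply/negP => d0.
set q := dot _ _ in d0; have N0 := sqr_ge0 (edist v p).
(* Moving from [p] towards [v] by the fraction [l] changes the squared distance to [w] by
   [- 2 l q + l^2 |v - p|^2]; this [l] keeps the quadratic term at most [l q], so the distance would
   decrease. *)
pose l := Num.min 1 (q / (edist v p ^+ 2 + 1)).
have l0 : 0 < l by rewrite lt_min ltr01 divr_gt0 //; lra.
have l1 : l <= 1 by rewrite ge_min lexx.
have lq : l * edist v p ^+ 2 <= q.
  have : l <= q / (edist v p ^+ 2 + 1) by rewrite ge_min lexx orbT.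
  by rewrite ler_pdivlMr; lra.
have : enorm (w - p) <= enorm (w - (l *: v + (1 - l) *: p)).
  by apply: hp; apply: cV => //; rewrite ltW.
rewrite -(@ler_pXn2r _ 2) ?nnegrE ?enorm_ge0 //.
have -> : w - (l *: v + (1 - l) *: p) = (w - p) - l *: (v - p).
  by apply/rowP => i; rewrite !mxE; ring.
have sqB y z : enorm (y - l *: z) ^+ 2 =
    enorm y ^+ 2 - 2 * (l * dot z y) + l * (l * enorm z ^+ 2).
  by rewrite !enorm_sqr dotBl !dotBr !dotZl !dotZr (dotC y z); ring.
rewrite sqB -/q -!/(edist _ _) => hh.
have lq0 : 0 < l * q by rewrite mulr_gt0.
have llq : l * (l * edist v p ^+ 2) <= l * q by rewrite ler_wpM2l // ltW.
by lra.
Qed.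

(** Compactness of [V] makes the separation uniform: step sizes tending to 0, with directions
    approaching [V] and endpoints in [C], would produce a tangent vector in [V]. *)
Lemma tangent_gap C V k : seq_compact V -> V `&` tangent_cone C k = set0 ->
  exists2 h, 0 < h & forall t v w, 0 < t -> t < h -> V v -> edist w v < h ->
    ~ C (k + t *: w).
Proof.
move=> cV VT; apply: contrapT => nh.
have {}nh i : exists p : R * ('rV[R]_n * 'rV[R]_n),
    [/\ 0 < p.1, p.1 < i.+1%:R^-1, V p.2.1, edist p.2.2 p.2.1 < i.+1%:R^-1 &
      C (k + p.1 *: p.2.2)].
  apply: contrapT => nex; apply: nh; exists i.+1%:R^-1; first by rewrite invr_gt0.
  by move=> t v w t0 ti Vv wv Cw; apply: nex; exists (t, (v, w)).
case: (choice nh) => ps hps.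
have [|v [s [Vv si hs]]] := cV (fun i => (ps i).2.1) _.
  by move=> i; have [] := hps i.
suff : (V `&` tangent_cone C k) v by rewrite VT.
split => //; exists (fun i => (ps (s i)).1), (fun i => (ps (s i)).2.2).
split; first by move=> i; have [] := hps (s i).
split; last split.
- apply/cvgrPdist_lt => e /(natSinv_lt)[N hN]; exists N => // i /= Ni.
  have [p0 ph _ _ _] := hps (s i); rewrite sub0r normrN gtr0_norm //.
  exact: lt_trans ph (hN _ (leq_trans Ni (si i))).
- apply: enorm_cvg => e e0.
  have [|N hN] := natSinv_lt (e / 2); first lra.
  exists N => i Ni; have [_ _ _ h1 _] := hps (s i).
  have := edist_triangle (ps (s i)).2.1 (ps (s i)).2.2 v.
  have := lt_trans (hs i) (hN i Ni).
  by have := lt_trans h1 (hN _ (leq_trans Ni (si i))); lra.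
- by move=> i; have [] := hps (s i).
Qed.

End SetValuedMaps.

(** * Displacement and mean slope of arcs of the differential inclusion *)

Section Arcs.
Context {R : realType} {n : nat}.
Implicit Types (C V : set 'rV[R]_n) (F : setmap R n) (x : R -> 'rV[R]_n).

Definition is_arc C F (a b : R) x : Prop :=
  [/\ a <= b, abs_cont_on a b x, forall t, a <= t <= b -> C (x t) &
      {ae @lebesgue_measure R, forall t, a <= t <= b ->
         derivable x t 1 /\ F (x t) ('D_1 x t)}].

Lemma ae_impl (P Q : R -> Prop) : (forall t, P t -> Q t) ->
  {ae @lebesgue_measure R, forall t, P t} -> {ae @lebesgue_measure R, forall t, Q t}.
Proof.
move=> PQ [A [mA A0 NA]]; exists A; split => // t nQ.
by apply: NA => Pt; exact: nQ (PQ t Pt).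
Qed.

Lemma is_arc_sub C F a b a' b' x :
  a <= a' -> a' <= b' -> b' <= b -> is_arc C F a b x -> is_arc C F a' b' x.
Proof.
move=> aa ab bb [_ ac Cx dx]; split => //.
- move=> e e0; have [d d0 hd] := ac e e0; exists d => // m xa xb h1; apply: hd.
  by move=> k /h1[? [? ?]]; split; [lra | split => //; lra].
- by move=> t /andP[at_ tb]; apply: Cx; apply/andP; split; lra.
- apply: ae_impl dx => t + /andP[at_ tb]; apply.
  by apply/andP; split; lra.
Qed.

Lemma abs_cont_unif_continuous (a b : R) x : abs_cont_on a b x ->
  forall g : R, 0 < g -> exists2 d : R, 0 < d & forall u v,
    a <= u <= b -> a <= v <= b -> `|u - v| < d -> edist (x u) (x v) < g.
Proof.
move=> ac g g0; have [d d0 hd] := ac g g0; exists d => //.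
have key u v : a <= u -> u <= v -> v <= b -> v - u < d -> edist (x v) (x u) < g.
  move=> au uv vb vu.
  have := hd 1%N (fun=> u) (fun=> v); rewrite !big_ord_recr !big_ord0 /= !add0r.
  by apply => // k l kl; rewrite ltnS leqn0 => /eqP l0; rewrite l0 in kl.
move=> u v /andP[au ub] /andP[av vb]; rewrite ltr_norml => /andP[uv vu].
have [le|lt] := leP u v; first by rewrite edistC; apply: key => //; lra.
by apply: key => //; lra.
Qed.

(** The first-order errors at [u] and [v] are at most [h (t - u)] and [h (v - t)]; as [t] lies
    between, they add up to [h (v - u)]. *)
Lemma derivable_slope_le (a b : R) x e (c t : R) :
  derivable x t 1 -> dot ('D_1 x t) e <= c -> slope_le a b x e c t.
Proof.
move=> dx De h h0.
have {}dx : (fun s : R => s^-1 *: ((x \o shift t) (s *: 1) - x t)) @ 0^' -->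
  'D_1 x t by exact: dx.
have e0 := enorm_ge0 e.
pose q := h / (enorm e + 1) / n.+1%:R.
have q0 : 0 < q by rewrite !divr_gt0 //; lra.
have [d /= d0 hd] := (nbhs_ballP _ _).1 ((cvgrPdist_lt _ _).1 dx q q0).
have near s : `|s| < d ->
    `|dot (x (t + s) - x t - s *: 'D_1 x t) e| <= h * `|s|.
  move=> sd; have [->|s0] := eqVneq s 0.
    rewrite addr0 subrr scale0r subr0 normr0 mulr0.
    by apply: le_trans (norm_dot_le _ _) _; rewrite enorm0 mul0r.
  have /= := hd s _ s0; rewrite /ball /= sub0r normrN => /(_ sd).
  rewrite [s *: 1]mulr1 [s + t]addrC => lt.
  apply: le_trans (norm_dot_le _ _) _.
  have -> : x (t + s) - x t - s *: 'D_1 x t =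
      (- s) *: ('D_1 x t - s^-1 *: (x (t + s) - x t)).
    by rewrite scalerBr scalerA mulNr divff // scaleN1r opprK addrC scaleNr.
  rewrite enormZ normrN [h * _]mulrC -mulrA ler_wpM2l //.
  set D := _ - _ in lt *.
  have Dq : enorm D <= h / (enorm e + 1).
    apply: le_trans (enorm_le_normr _) _.
    have : n.+1%:R * `|D| <= h / (enorm e + 1).
      by rewrite mulrC -ler_pdivlMr ?ltr0n // ltW.
    by apply: le_trans; rewrite ler_wpM2r // ler_nat.
  rewrite ler_pdivlMr in Dq; last lra.
  by have := enorm_ge0 D; nra.
exists d => // u v au ut tv vb tu vt.
have tvE : t + (v - t) = v by ring.
have tuE : t + (u - t) = u by ring.
have := near (v - t); rewrite ger0_norm ?subr_ge0 // tvE => /(_ vt).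
have := near (u - t); rewrite ler0_norm ?subr_le0 // opprB tuE => /(_ tu).
rewrite !ler_norml !dotBl !dotZl => /andP[h1 h2] /andP[h3 h4].
have : (v - u) * dot ('D_1 x t) e <= (v - u) * c by rewrite ler_wpM2l //; lra.
by lra.
Qed.

Lemma arc_dot_le C F a b x e c : is_arc C F a b x ->
  (forall t y, a <= t <= b -> F (x t) y -> dot y e <= c) ->
  dot (x b - x a) e <= c * (b - a).
Proof.
move=> [ab ac _ dx] hF; apply: abs_cont_dot_le => //.
apply: ae_impl dx => t + tab => /(_ tab)[dt Ft].
by apply: derivable_slope_le => //; exact: hF Ft.
Qed.

Lemma arc_speed C F a b x L : is_arc C F a b x -> 0 <= L ->
  (forall t y, a <= t <= b -> F (x t) y -> enorm y <= L) ->
  edist (x b) (x a) <= L * (b - a).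
Proof.
move=> ax L0 hF; have ab : a <= b by case: ax.
have : dot (x b - x a) (x b - x a) <= L * edist (x b) (x a) * (b - a).
  apply: arc_dot_le ax _ => t y tab /(hF t y tab) yL.
  by apply: le_trans (dot_le_enorm _ _) _; rewrite ler_wpM2r // edist_ge0.
rewrite -enorm_sqr -/(edist _ _) => h; rewrite leNgt; apply/negP => lt.
have : 0 <= L * (b - a) by rewrite mulr_ge0 //; lra.
by nra.
Qed.

Lemma arc_stay C F a b x k (r L c : R) : is_arc C F a b x -> 0 <= L ->
  (forall z y, C z -> edist z k < r -> F z y -> enorm y <= L) ->
  a <= c <= b -> edist (x c) k + L * (b - a) < r ->
  forall t, a <= t <= b -> edist (x t) k < r /\ edist (x t) (x c) <= L * (b - a).
Proof.
move=> ax L0 hL /andP[ac cb] xck; have [ab acx Cx _] := ax.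
(* Continuation in the half-width [h] of a window around [c]: as long as [x] stays in the ball, its
   speed is at most [L], so it keeps a fixed margin to the boundary, and uniform continuity lets the
   window grow. *)
pose P h := forall t, a <= t <= b -> `|t - c| <= h -> edist (x t) k < r.
have speed h : P h -> forall t, a <= t <= b -> `|t - c| <= h ->
    edist (x t) (x c) <= L * (b - a).
  have F1 p q : a <= p -> p <= q -> q <= b ->
      (forall t, p <= t <= q -> edist (x t) k < r) ->
      edist (x q) (x p) <= L * (b - a).
    move=> ap pq qb hpq; apply: (@le_trans _ _ (L * (q - p))); last by nra.
    apply: (arc_speed C F) => //; first exact: is_arc_sub ax.
    move=> t y /andP[pt tq]; apply: hL; last by apply: hpq; apply/andP.
    by apply: Cx; apply/andP; split; lra.
  move=> Ph t /andP[at_ tb]; rewrite ler_norml => /andP[tc1 tc2].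
  have [tc|ct] := leP t c.
    rewrite edistC; apply: F1 => // s /andP[ts sc]; apply: Ph.
      by apply/andP; split; lra.
    by rewrite ler_norml; lra.
  apply: F1 => //; first lra.
  move=> s /andP[cs st]; apply: Ph; first by apply/andP; split; lra.
  by rewrite ler_norml; lra.
have Pb : P (b - a).
  have Lba : 0 <= L * (b - a) by rewrite mulr_ge0 //; lra.
  apply: (cousin_induction 0 (b - a)); first lra.
    move=> t _; rewrite normr_le0 subr_eq0 => /eqP ->; lra.
  have g0 : 0 < r - edist (x c) k - L * (b - a) by lra.
  have [d d0 hd] := abs_cont_unif_continuous a b x acx _ g0.
  move=> s s0 sb; exists (d / 2); first lra.
  move=> u v u0 us sv vb su vs Pu t tab tv.
  have [tu|ut] := leP `|t - c| u; first exact: Pu.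
  have [t' [tab' t'c tt']] : exists t', [/\ a <= t' <= b, `|t' - c| <= u & `|t - t'| < d].
    move: ut tv; move/andP: tab => [at_ tb].
    have [tc|ct] := leP t c.
      rewrite ler0_norm; last lra. move=> ut tv; exists (c - u); split.
      - by apply/andP; split; lra.
      - by rewrite ler_norml; lra.
      - by rewrite ltr_norml; lra.
    rewrite gtr0_norm; last lra. move=> ut tv; exists (c + u); split.
    - by apply/andP; split; lra.
    - by rewrite ler_norml; lra.
    - by rewrite ltr_norml; lra.
  have := hd t t' tab tab' tt'; have := speed u Pu t' tab' t'c.
  have := edist_triangle (x c) (x t') k.
  have := edist_triangle (x t') (x t) k.
  by lra.
move=> t tab; have tc : `|t - c| <= b - a.
  by move/andP: tab => [? ?]; rewrite ler_norml; lra.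
by split; [exact: Pb | exact: speed tc].
Qed.

(** A mean value theorem for convex sets. If [p] is the projection on [V] of the mean slope [w],
    every velocity [y] satisfies [dot y (w - p) <= dot p (w - p) + h |w - p|]; applying [arc_dot_le]
    gives [|w - p|^2 <= h |w - p|]. *)
Lemma arc_slope_near C F a b x V (h : R) : is_arc C F a b x -> a < b -> 0 <= h ->
  seq_compact V -> V !=set0 -> hconvex_set V ->
  (forall t y, a <= t <= b -> F (x t) y -> exists2 v, V v & edist y v < h) ->
  exists2 p, V p & edist ((b - a)^-1 *: (x b - x a)) p <= h.
Proof.
move=> ax ab h0 cV V0 vV hV; set w := _ *: _.
have [p Vp hp] := seq_compact_projection V w cV V0.
exists p => //.
have : dot (x b - x a) (w - p) <=
    (dot p (w - p) + h * edist w p) * (b - a).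
  apply: arc_dot_le ax _ => t y tab /(hV t y tab)[v Vv yv].
  have := projection_dot_le V w p v vV Vp Vv hp.
  have := dot_le_enorm (y - v) (w - p); rewrite -!/(edist _ _).
  have := edist_ge0 w p.
  by rewrite !(dotBl _ _ (w - p)); nra.
rewrite -ler_pdivrMr ?subr_gt0 // mulrC -dotZl -/w -lerBlDl -dotBl -enorm_sqr -/(edist _ _).
move=> hh; rewrite leNgt; apply/negP => lt.
by nra.
Qed.

End Arcs.

(** * Long flows cannot start near [D] or end near [G(D)] *)

Section NoFlow.
Context {R : realType} {n : nat}.
Variables (C : set 'rV[R]_n) (F : setmap R n).
Hypotheses (clC : closed C) (oscF : osc_rel F C) (bddF : locbdd_rel F C).
Hypotheses (domF : C `<=` dom F) (cvxF : forall x, C x -> hconvex_set (F x)).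

(** The reference time [c] is arbitrary in the arc, so that both arcs leaving [k] and arcs arriving
    at [k] are covered. Since [e <= h * (q / 2)], replacing an endpoint by [k] moves the slope by
    less than [q / 2]. *)
Lemma short_arc_slope k (q tau : R) : C k -> 0 < q -> 0 < tau ->
  exists h e, [/\ 0 < h <= tau, h < q, 0 < e, e <= h * (q / 2) &
    forall a x c, is_arc C F a (a + h) x -> a <= c <= a + h ->
      edist (x c) k < e ->
      exists2 p, F k p & edist (h^-1 *: (x (a + h) - x a)) p <= q / 2].
Proof.
move=> Ck q0 tau0; have q20 : 0 < q / 2 by lra.
have [r1 r10 hr1] := osc_near C F k (q / 2) oscF bddF Ck q20.
have [r2 r20 [M hM]] := bddF k Ck.
pose r := Num.min r1 r2; pose L := `|M|.
have r0 : 0 < r by rewrite lt_min r10.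
have L0 : 0 <= L by exact: normr_ge0.
(* The bound [tau] lets the arc be cut out of a longer one, [q / 2] gives [h < q], and the last
   bound limits the travel to [r / 2], so the arc stays in the ball of radius [r]. *)
pose h := Num.min tau (Num.min (q / 2) (r / (2 * (L + 1)))).
have h0 : 0 < h by rewrite !lt_min tau0 q20 divr_gt0 // mulr_gt0 //; lra.
have htau : h <= tau by rewrite ge_min lexx.
have hq : h <= q / 2 by rewrite !ge_min lexx !orbT.
have hL : L * h <= r / 2.
  have : h <= r / (2 * (L + 1)) by rewrite !ge_min lexx !orbT.
  by rewrite ler_pdivlMr; [nra | lra].
pose e := Num.min (r / 2) (h * (q / 2)).
have e0 : 0 < e by rewrite lt_min [0 < h * _]mulr_gt0 // divr_gt0.
have er : e <= r / 2 by rewrite ge_min lexx.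
exists h, e; split => //; [by rewrite h0 | lra | by rewrite ge_min lexx orbT | ].
move=> a x c ax cab xck.
have ball t : a <= t <= a + h -> edist (x t) k < r.
  move=> tab; apply: (arc_stay C F a (a + h) x k r L c _ _ _ _ _ t tab).1 => //.
    move=> z y Cz zk Fzy; apply: le_trans (ler_norm M).
    by apply: (hM z y) => //; apply: lt_le_trans zk _; rewrite ge_min lexx orbT.
  by rewrite (addrC a) addrK; lra.
have ah : a < a + h by rewrite ltrDl.
have := arc_slope_near C F a (a + h) x (F k) (q / 2) ax ah (ltW q20).
rewrite (addrC a) addrK; apply.
- exact: osc_seq_compact oscF bddF Ck.
- exact: domF.
- exact: cvxF.
- rewrite (addrC h) => t y tab Fy; apply: (hr1 (x t)) => //; first by case: ax => _ _ /(_ t tab).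
  by apply: lt_le_trans (ball t tab) _; rewrite ge_min lexx.
Qed.

Lemma no_flow_from k (tau : R) : C k -> F k `&` tangent_cone C k = set0 -> 0 < tau ->
  exists2 e, 0 < e & forall a b x, is_arc C F a b x -> tau <= b - a ->
    ~ edist (x a) k < e.
Proof.
move=> Ck FT tau0.
have [q q0 hq] := tangent_gap C (F k) k
  (osc_seq_compact C F k oscF bddF Ck) FT.
have [h [e [/andP[h0 htau] hlq e0 eh hh]]] := short_arc_slope k q tau Ck q0 tau0.
exists e => // a b x ax ab xak.
have ax' : is_arc C F a (a + h) x by apply: is_arc_sub ax => //; lra.
have [|p Fp hp] := hh a x a ax' _ xak; first by apply/andP; split; lra.
apply: (hq h p (h^-1 *: (x (a + h) - k)) h0 hlq Fp); last first.
  rewrite scalerA divff ?gt_eqF // scale1r addrC subrK.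
  by case: ax' => _ _ + _; apply; apply/andP; split; lra.
apply: le_lt_trans (edist_triangle (h^-1 *: (x (a + h) - x a)) _ _) _.
have -> : edist (h^-1 *: (x (a + h) - k)) (h^-1 *: (x (a + h) - x a)) =
    h^-1 * edist (x a) k.
  rewrite /edist -scalerBr enormZ gtr0_norm ?invr_gt0 //; congr (_ * enorm _).
  by apply/rowP => i; rewrite !mxE; ring.
have : h^-1 * edist (x a) k < q / 2.
  by rewrite mulrC ltr_pdivrMr // mulrC; exact: lt_le_trans xak eh.
by lra.
Qed.

(** Time is reversed: the slope from [k] back to [x (b - h)] is close to the opposite of a point of
    [F k]. *)
Lemma no_flow_to k (tau : R) : C k -> [set - v | v in F k] `&` tangent_cone C k = set0 ->
  0 < tau ->
  exists2 e, 0 < e & forall a b x, is_arc C F a b x -> tau <= b - a ->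
    ~ edist (x b) k < e.
Proof.
move=> Ck FT tau0.
have [q q0 hq] := tangent_gap C _ k
  (seq_compact_opp _ (osc_seq_compact C F k oscF bddF Ck)) FT.
have [h [e [/andP[h0 htau] hlq e0 eh hh]]] := short_arc_slope k q tau Ck q0 tau0.
exists e => // a b x ax ab xbk.
pose a' := b - h; have ba' : b = a' + h by rewrite subrK.
have ax' : is_arc C F a' (a' + h) x.
  by rewrite -ba'; apply: is_arc_sub ax => //; rewrite /a'; lra.
rewrite ba' in xbk.
have [|p Fp hp] := hh a' x (a' + h) ax' _ xbk; first by apply/andP; split; lra.
apply: (hq h (- p) (h^-1 *: (x a' - k)) h0 hlq); first by exists p.
  apply: le_lt_trans (edist_triangle (- (h^-1 *: (x (a' + h) - x a'))) _ _) _.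
  have -> : edist (h^-1 *: (x a' - k)) (- (h^-1 *: (x (a' + h) - x a'))) =
      h^-1 * edist (x (a' + h)) k.
    rewrite /edist -scalerN -scalerBr enormZ gtr0_norm ?invr_gt0 //.
    by congr (_ * enorm _); apply/rowP => i; rewrite !mxE; ring.
  have -> : edist (- (h^-1 *: (x (a' + h) - x a'))) (- p) =
      edist (h^-1 *: (x (a' + h) - x a')) p.
    by rewrite edistC /edist opprK addrC.
  have : h^-1 * edist (x (a' + h)) k < q / 2.
    by rewrite mulrC ltr_pdivrMr // mulrC; exact: lt_le_trans xbk eh.
  by lra.
rewrite scalerA divff ?gt_eqF // scale1r addrC subrK.
by case: ax' => _ _ + _; apply; apply/andP; split; lra.
Qed.

(** A single [e] is both the radius and, inverted, the bound; this makes the property monotone, as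
    [seq_compact_uniform] requires. Around points outside the closed set [C] it is vacuous. *)
Lemma locbdd_uniform (K : set 'rV[R]_n) : seq_compact K ->
  exists2 e, 0 < e & forall k z y, K k -> C z -> edist z k < e -> F z y ->
    enorm y <= e^-1.
Proof.
move=> cK.
have [||e e0 he] := seq_compact_uniform K
  (fun k e => forall z y, C z -> edist z k < e -> F z y -> enorm y <= e^-1) cK.
- move=> k e e' e'0 ee hk z y Cz zk Fy.
  apply: (@le_trans _ _ e^-1); first by apply: (hk z) => //; exact: lt_le_trans zk ee.
  by rewrite lef_pV2 ?posrE //; exact: lt_le_trans ee.
- move=> k _; have [Ck|nCk] := pselect (C k); last first.
    have [e e0 he] := closed_eball C k clC nCk.
    exists (e / 2) => [|k' _ kk z y Cz zk]; first lra.
    exfalso; apply: (he z) Cz.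
    by have := edist_triangle k' z k; lra.
  have [r r0 [M hM]] := bddF k Ck.
  pose e := Num.min (r / 2) (`|M| + 1)^-1.
  have M0 : 0 < `|M| + 1 by rewrite ltr_wpDl.
  have e0 : 0 < e by rewrite lt_min; apply/andP; split; [lra | rewrite invr_gt0].
  have er : e <= r / 2 by rewrite ge_min lexx.
  exists e => // k' _ kk z y Cz zk Fy.
  apply: (@le_trans _ _ (`|M| + 1)).
    apply: (@le_trans _ _ M); last by apply: le_trans (ler_norm M) _; rewrite lerDl.
    apply: (hM z) => //; rewrite -/(edist z k).
    by have := edist_triangle k' z k; lra.
  rewrite -[X in X <= _]invrK lef_pV2 ?posrE ?invr_gt0 //.
  by rewrite ge_min lexx orbT.
- by exists e => // k z y Kk; exact: he.
Qed.

Lemma no_flow_from_uniform (K : set 'rV[R]_n) (tau : R) : seq_compact K ->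
  (forall k, K k -> C k -> F k `&` tangent_cone C k = set0) -> 0 < tau ->
  exists2 e, 0 < e & forall k a b x, K k -> is_arc C F a b x -> tau <= b - a ->
    ~ edist (x a) k < e.
Proof.
move=> cK hK tau0.
have [||e e0 he] := seq_compact_uniform K
  (fun k e => forall a b x, is_arc C F a b x -> tau <= b - a ->
    ~ edist (x a) k < e) cK.
- move=> k e e' e'0 ee hk a b x ax ab xak; apply: (hk a b x) => //.
  exact: lt_le_trans xak ee.
- move=> k Kk; suff [e e0 he] : exists2 e, 0 < e & forall a b x,
      is_arc C F a b x -> tau <= b - a -> ~ edist (x a) k < e.
    exists (e / 2) => [|k' _ kk a b x ax ab xak]; first lra.
    apply: (he a b x) => //; have := edist_triangle k' (x a) k; lra.
  have [Ck|nCk] := pselect (C k); first exact: no_flow_from (hK k Kk Ck) tau0.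
  have [e e0 he] := closed_eball C k clC nCk.
  exists e => // a b x [ab _ Cx _] _ /he; apply; apply: Cx.
  by rewrite lexx.
- by exists e => // k a b x Kk; exact: he.
Qed.

Lemma no_flow_to_uniform (K : set 'rV[R]_n) (tau : R) : seq_compact K ->
  (forall k, K k -> C k -> [set - v | v in F k] `&` tangent_cone C k = set0) ->
  0 < tau ->
  exists2 e, 0 < e & forall k a b x, K k -> is_arc C F a b x -> tau <= b - a ->
    ~ edist (x b) k < e.
Proof.
move=> cK hK tau0.
have [||e e0 he] := seq_compact_uniform K
  (fun k e => forall a b x, is_arc C F a b x -> tau <= b - a ->
    ~ edist (x b) k < e) cK.
- move=> k e e' e'0 ee hk a b x ax ab xbk; apply: (hk a b x) => //.
  exact: lt_le_trans xbk ee.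
- move=> k Kk; suff [e e0 he] : exists2 e, 0 < e & forall a b x,
      is_arc C F a b x -> tau <= b - a -> ~ edist (x b) k < e.
    exists (e / 2) => [|k' _ kk a b x ax ab xbk]; first lra.
    apply: (he a b x) => //; have := edist_triangle k' (x b) k; lra.
  have [Ck|nCk] := pselect (C k); first exact: no_flow_to (hK k Kk Ck) tau0.
  have [e e0 he] := closed_eball C k clC nCk.
  exists e => // a b x [ab _ Cx _] _ /he; apply; apply: Cx.
  by rewrite lexx andbT.
- by exists e => // k a b x Kk; exact: he.
Qed.

End NoFlow.

(** * Structure of hybrid time domains and of solutions around jumps *)

Section TimeDomain.
Context {R : realType} {n : nat}.
Variables (C D : set 'rV[R]_n) (F G : setmap R n).

(** The corners [(t J', J')] and [(t J.+1, J)] of the truncated domain belong to it, which forces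
    the last index to be [J] and the last time to be [T]. *)
Lemma htd_times (E : set (R * nat)) T J : hybrid_time_domain E -> E (T, J) ->
  exists t : nat -> R, [/\ t 0%N = 0, {homo t : i j / (i <= j)%N >-> i <= j},
    t J.+1 = T & forall s k, (k <= J)%N -> s <= T ->
      (E (s, k) <-> t k <= s /\ s <= t k.+1)].
Proof.
move=> [_ hE] ETJ; have [J' [t [t0 [tS ht]]]] := hE T J ETJ.
have tmono : {homo t : i j / (i <= j)%N >-> i <= j}.
  by apply: homo_leq => //; exact: le_trans.
have [JJ' [tJ tJ1]] := (ht T J).1 (conj ETJ (conj (lexx T) (leqnn J))).
have J'J : (J' <= J)%N.
  by have [_ [_ ?]] := (ht (t J') J').2 (conj (leqnn J') (conj (lexx _) (tS J'))).
have tJT : t J.+1 = T.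
  have [_ [le _]] := (ht (t J.+1) J).2 (conj JJ' (conj (tS J) (lexx _))).
  by apply/eqP; rewrite eq_le le.
exists t; split => // s k kJ sT; split => [Es | [h1 h2]].
  by have [_ ?] := (ht s k).1 (conj Es (conj sT kJ)).
by have [? _] := (ht s k).2 (conj (leq_trans kJ JJ') (conj h1 h2)).
Qed.

Lemma htd_interval (E : set (R * nat)) a b j s : hybrid_time_domain E ->
  E (a, j) -> E (b, j) -> a <= s -> s <= b -> E (s, j).
Proof.
move=> hE Ea Eb as_ sb; have [t [_ _ tb ht]] := htd_times E b j hE Eb.
have [ta _] := (ht a j (leqnn j) (le_trans as_ sb)).1 Ea.
by apply: (ht s j (leqnn j) sb).2; rewrite tb; split => //; exact: le_trans as_.
Qed.

Lemma htd_jump_before (E : set (R * nat)) s t j : hybrid_time_domain E ->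
  E (t, j) -> 0 <= s -> s <= t -> ~ E (s, j) ->
  exists t' i, [/\ j = i.+1, s < t', t' <= t, E (t', i) & E (t', i.+1)].
Proof.
move=> hE Et s0 st nEs; have [T [T0 Tm Tt hT]] := htd_times E t j hE Et.
have sT : s < T j.
  by rewrite ltNge; apply/negP => le; apply/nEs/(hT s j (leqnn j) st); rewrite Tt.
case: j => [|i] in Et nEs Tt hT sT *; first by move: sT; rewrite T0 ltNge s0.
have Tit : T i.+1 <= t by rewrite -Tt; exact: Tm.
exists (T i.+1), i; split => //.
  by apply: (hT _ _ (leqnSn i) Tit).2; split => //; exact: Tm.
by apply: (hT _ _ (leqnn _) Tit).2; split => //; exact: Tm.
Qed.

Lemma htd_zero (E : set (R * nat)) i : hybrid_time_domain E -> E (0, i.+1) -> E (0, i).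
Proof.
move=> hE Ei; have [t [t0 tm te ht]] := htd_times E 0 i.+1 hE Ei.
have tz k : (k <= i.+2)%N -> t k = 0.
  by move=> k2; apply/eqP; rewrite eq_le -{1}te -t0 !tm.
by apply: (ht 0 i (leqnSn i) (lexx 0)).2; rewrite !tz //; exact: leqW.
Qed.

Lemma sol_time_ge0 E phi (s : R) i : is_solution C F D G E phi -> E (s, i) -> 0 <= s.
Proof. by case=> -[[+ _] _] _ _ _ _; apply. Qed.

Lemma sol_jump E phi (s : R) i : is_solution C F D G E phi -> E (s, i) -> E (s, i.+1) ->
  D (phi s i) /\ G (phi s i) (phi s i.+1).
Proof. by case=> _ _ _ _; apply. Qed.

Lemma sol_arc E phi a b j : closed C -> is_solution C F D G E phi ->
  E (a, j) -> E (b, j) -> a < b -> is_arc C F a b (phi ^~ j).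
Proof.
move=> clC [[hE _] _ ac fl _] Ea Eb ab.
have Es s : a <= s <= b -> E (s, j).
  by move=> /andP[? ?]; exact: (htd_interval E a b j s hE).
have acx : abs_cont_on a b (phi ^~ j).
  by apply: ac => [|s /=]; [exact: ltW | rewrite in_itv /=; exact: Es].
have int s : a < s < b -> int_Ij E j s by move=> /andP[? ?]; exists a, b.
have [|Cint dx] := fl j.
  by exists ((a + b) / 2); apply: int; apply/andP; split; lra.
split => //; [exact: ltW | | by apply: ae_impl dx => t + /Es; apply].
(* [is_solution] places only the interior of a flow interval in [C]; closedness of [C] extends this
   to the endpoints through nearby interior times. *)
move=> t /andP[at_ tb]; apply: contrapT => nC.
have [e e0 he] := closed_eball C _ clC nC.
have [d d0 hd] := abs_cont_unif_continuous a b _ acx e e0.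
have [s [sab std]] : exists s, a < s < b /\ `|s - t| < d.
  have [ta|ta] := leP t a.
    exists (Num.min ((a + b) / 2) (a + d / 2)).
    have [h|h] := leP ((a + b) / 2) (a + d / 2).
      by split; [apply/andP; split | rewrite ltr_norml]; lra.
    by split; [apply/andP; split | rewrite ltr_norml]; lra.
  exists (Num.max ((a + t) / 2) (t - d / 2)).
  have [h|h] := leP ((a + t) / 2) (t - d / 2).
    by split; [apply/andP; split | rewrite ltr_norml]; lra.
  by split; [apply/andP; split | rewrite ltr_norml]; lra.
apply: (he (phi s j)); last exact/Cint/int.
move/andP: sab => [as_ sb].
by apply: (hd s t) => //; apply/andP; split; lra.
Qed.

Hypotheses (clC : closed C) (oscF : osc_rel F C) (bddF : locbdd_rel F C).
Hypotheses (domF : C `<=` dom F) (cvxF : forall x, C x -> hconvex_set (F x)).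
Hypothesis GD : simage G D `&` D = set0.
Hypothesis FT : forall x, C x -> D x -> F x `&` tangent_cone C x = set0.

(* [hybrid_time_domain] truncates to [0, T] x {0..J}, hence admits domains such
   as [0, 2] x {0} U {1} x {1} that go on flowing after a jump; the solution
   would then flow out of a point of C `&` D. *)
Lemma sol_no_branch E phi t t' j : is_solution C F D G E phi ->
  E (t, j) -> E (t, j.+1) -> E (t', j) -> t' <= t.
Proof.
move=> sol Et Et1 Et'; rewrite leNgt; apply/negP => tt'.
have ax := sol_arc E phi t t' j clC sol Et Et' tt'.
have Cx : C (phi t j) by case: ax => _ _ + _; apply; rewrite lexx ltW.
have Dx : D (phi t j) by have [] := sol_jump E phi t j sol Et Et1.
have tau0 : 0 < t' - t by lra.
have [e e0 he] :=
  no_flow_from C F oscF bddF domF cvxF _ (t' - t) Cx (FT _ Cx Dx) tau0.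
by apply: (he t t' _ ax) => //; rewrite edistxx.
Qed.

Lemma sol_time_le E phi s t k j : is_solution C F D G E phi ->
  E (s, k) -> E (t, j) -> (k < j)%N -> s <= t.
Proof.
move=> sol Es Et kj; have hE : hybrid_time_domain E by case: sol => -[].
have [T [_ Tm Tt hT]] := htd_times E t j hE Et.
have Tk : T k.+1 <= t by rewrite -Tt; apply: Tm; exact: leqW.
apply: (le_trans _ Tk); apply: (sol_no_branch E phi) sol _ _ Es.
  by apply: (hT _ _ (ltnW kj) Tk).2; split => //; exact: Tm.
by apply: (hT _ _ kj Tk).2; split => //; exact: Tm.
Qed.

Lemma sol_index_unique E phi a b s j k : is_solution C F D G E phi ->
  E (a, j) -> E (b, j) -> a < s -> s < b -> E (s, k) -> k = j.
Proof.
move=> sol Ea Eb as_ sb Es; have [kj|jk|//] := ltngtP k j.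
  by exfalso; have := sol_time_le E phi s a k j sol Es Ea kj; lra.
by exfalso; have := sol_time_le E phi b s j k sol Eb Es jk; lra.
Qed.

Lemma sol_jump_after E phi t b j : is_solution C F D G E phi -> t_complete E ->
  E (t, j) -> t < b ->
  E (b, j) \/ exists t', [/\ t <= t', t' < b, E (t', j) & E (t', j.+1)].
Proof.
move=> sol tc Et tb; have hE : hybrid_time_domain E by case: sol => -[].
have [T [J [ET bT]]] := tc b.
have [jJ|Jj] := leqP j J; last first.
  by exfalso; have := sol_time_le E phi T t J j sol ET Et Jj; lra.
have [s [_ sm sT hs]] := htd_times E T J hE ET.
have [sj sj1] := (hs t j jJ (le_trans (ltW tb) bT)).1 Et.
have sjT : s j.+1 <= T by rewrite -sT; exact: sm.
have [bs|sb] := leP b (s j.+1).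
  by left; apply: (hs b j jJ bT).2; split => //; lra.
right; exists (s j.+1); split => //.
  by apply: (hs _ _ jJ sjT).2; split => //; exact: sm.
have jJ1 : (j < J)%N.
  rewrite ltn_neqAle jJ andbT; apply/eqP => jE.
  by move: sb; rewrite jE sT; lra.
by apply: (hs _ _ jJ1 sjT).2; split => //; exact: sm.
Qed.

(** Two jumps at the same time would put a point of [G(D)] in [D], so a jump at a positive time ends
    a flow interval of positive length. *)
Lemma sol_flow_before_jump E phi t j : is_solution C F D G E phi ->
  E (t, j) -> E (t, j.+1) -> 0 < t -> exists2 a, a < t & E (a, j).
Proof.
move=> sol Et Et1 t0; have hE : hybrid_time_domain E by case: sol => -[].
have [s [s0 sm st hs]] := htd_times E t j hE Et.
have sjt : s j <= t by rewrite -st; exact: sm.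
have Esj : E (s j, j) by apply: (hs _ _ (leqnn j) sjt).2; split => //; exact: sm.
have [lt|ge] := ltP (s j) t; first by exists (s j).
have sjE : s j = t by apply/eqP; rewrite eq_le sjt.
case: j => [|i] in Et Et1 hs st sjt Esj ge sjE *; first by move: t0; rewrite -sjE s0 ltxx.
have Eti : E (t, i).
  by apply: (hs _ _ (leqnSn i) (lexx t)).2; rewrite sjE -[in X in X /\ _]sjE sm.
suff : (simage G D `&` D) (phi t i.+1) by rewrite GD.
have [Di Gi] := sol_jump E phi t i sol Eti Et.
have [Di1 _] := sol_jump E phi t i.+1 sol Et Et1.
by split => //; exists (phi t i).
Qed.

End TimeDomain.

Arguments sol_time_ge0 {R n C D F G E phi s i}.
Arguments sol_jump {R n C D F G E phi s i}.

(** * Uniform continuity of the jump map and separation of [D] from [G(D)] *)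

Section JumpMap.
Context {R : realType} {n : nat}.
Variables (D : set 'rV[R]_n) (G : setmap R n).
Hypotheses (clD : closed D) (oscG : osc_rel G D) (bddG : locbdd_rel G D).
Hypotheses (domG : D `<=` dom G) (GD : simage G D `&` D = set0).
Hypotheses (svG : single_valued G) (propG : proper_map G).

Lemma jump_unique x y z : G x y -> G x z -> y = z.
Proof.
move=> Gy; have [|v Gv] := svG x; first by exists y.
by move: Gy; rewrite Gv => -> ->.
Qed.

Lemma proper_coercive (M : R) :
  exists M' : R, forall x y, G x y -> enorm y <= M -> enorm x <= M'.
Proof.
have cB : compact [set y : 'rV[R]_n | enorm y <= M].
  apply: bounded_closed_compact.
    exists M; split; first exact: num_real.
    by move=> r Mr y /= yM; apply: le_trans (normr_le_enorm _) _; lra.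
  move=> y cly /=; apply/ler_addgt0Pr => e e0.
  have q0 : 0 < e / n.+1%:R by rewrite divr_gt0.
  have [z [/= zM]] := cly _ (nbhsx_ballx y _ q0).
  rewrite mx_norm_ball /= /ball_ /= => yz.
  apply: le_trans (enorm_le_dist y z) _; rewrite lerD //.
  apply: le_trans (enorm_le_normr _) _.
  apply: (@le_trans _ _ (n.+1%:R * `|y - z|)); first by rewrite ler_wpM2r // ler_nat.
  by rewrite mulrC -ler_pdivlMr // ltW.
have [M0 [_ hM0]] := compact_bounded (propG _ cB).
exists (n%:R * (`|M0| + 1)) => x y Gxy yM.
apply: le_trans (enorm_le_normr _) _; rewrite ler_wpM2l //.
apply: (hM0 (`|M0| + 1)); last by exists y.
by apply: le_lt_trans (ler_norm M0) _; rewrite ltrDl.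
Qed.

Lemma jump_continuous k (e : R) : D k -> 0 < e -> exists2 d, 0 < d &
  forall v y z, D v -> edist v k < d -> G v y -> G k z -> edist y z < e.
Proof.
move=> Dk e0; have [d d0 hd] := osc_near D G k e oscG bddG Dk e0.
exists d => // v y z Dv vk Gy Gz; have [z' Gz' yz'] := hd v y Dv vk Gy.
by rewrite (jump_unique _ _ _ Gz Gz').
Qed.

Variable K : set 'rV[R]_n.
Hypotheses (cK : seq_compact K) (KD : K `<=` D).

Lemma jump_unif_continuous (e : R) : 0 < e -> exists2 d, 0 < d &
  forall k v y z, K k -> D v -> edist v k < d -> G v y -> G k z ->
    edist y z < e.
Proof.
move=> e0.
have [||d d0 hd] := seq_compact_uniform K (fun k d => forall v y z, D v ->
  edist v k < d -> G v y -> G k z -> edist y z < e) cK.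
- move=> k d d' d'0 dd hk v y z Dv vk; apply: hk => //; exact: lt_le_trans dd.
- move=> k Kk; have [|d d0 hd] := jump_continuous k (e / 2) (KD k Kk); first lra.
  exists (d / 2) => [|k' Kk' kk v y z Dv vk Gy Gz]; first lra.
  have [y0 Gy0] := domG k (KD k Kk).
  have h1 := edist_triangle k' v k.
  have h2 : edist y y0 < e / 2 by apply: (hd v) => //; lra.
  have h3 : edist z y0 < e / 2 by apply: (hd k') => //; [exact: KD | lra].
  by have := edist_triangle y0 y z; rewrite (edistC y0 z); lra.
- by exists d => // k v y z Kk; exact: hd.
Qed.

Lemma jump_image_seq_compact : seq_compact (simage G K).
Proof.
move=> zs hzs.
have h i : exists u, K u /\ G u (zs i) by have [u Ku Gu] := hzs i; exists u.
case: (choice h) => us hus.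
have [u [s [Ku si hs]]] := cK us (fun i => (hus i).1).
have [z Gz] := domG u (KD u Ku).
have {}h i : exists k, (i <= k)%N /\ edist (zs k) z < i.+1%:R^-1.
  have [|d d0 hd] := jump_continuous u i.+1%:R^-1 (KD u Ku); first by rewrite invr_gt0.
  have [N hN] := natSinv_lt d d0.
  exists (s (maxn N i)); split; first exact: leq_trans (leq_maxr N i) (si _).
  have [Kus Gus] := hus (s (maxn N i)).
  apply: (hd (us (s (maxn N i)))) => //; first exact: KD.
  exact: lt_trans (hs _) (hN _ (leq_maxl N i)).
case: (choice h) => s' hs'; exists z, s'; split; first by exists u.
  by move=> i; have [] := hs' i.
by move=> i; have [] := hs' i.
Qed.

(** [G(D)] may be unbounded, so properness supplies the compactness: points of [G(D)] approaching
    [k] have bounded preimages, and a limit [v] of these gives [k] in [G v], against [GD]. *)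
Lemma jump_image_far : exists2 d, 0 < d &
  forall k y, K k -> simage G D y -> ~ edist y k < d.
Proof.
have [||d d0 hd] := seq_compact_uniform K (fun k d => forall y,
  simage G D y -> ~ edist y k < d) cK.
- by move=> k d d' d'0 dd hk y /hk h yk; apply: h; exact: lt_le_trans yk dd.
- move=> k Kk; suff [d d0 hd] : exists2 d, 0 < d & forall y,
      simage G D y -> ~ edist y k < d.
    exists (d / 2) => [|k' _ kk y Gy yk]; first lra.
    by apply: (hd y Gy); have := edist_triangle k' y k; lra.
  apply: contrapT => nh.
  have {}nh i : exists p : 'rV[R]_n * 'rV[R]_n,
      [/\ D p.1, G p.1 p.2 & edist p.2 k < i.+1%:R^-1].
    apply: contrapT => nex; apply: nh; exists i.+1%:R^-1; first by rewrite invr_gt0.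
    by move=> y [v Dv Gv] yk; apply: nex; exists (v, y).
  case: (choice nh) => ps hps.
  have [M' hM'] := proper_coercive (enorm k + 1).
  have [|v [s [[Dv _] si hs]]] :=
      closed_seq_compact D M' clD (fun i => (ps i).1) _.
    move=> i; have [Dp Gp pk] := hps i; split => //=; apply: hM' Gp _.
    have := enorm_le_dist (ps i).2 k.
    have : i.+1%:R^-1 <= 1 :> R by rewrite invf_le1 ?ltr0n // ler1n.
    move=> i1; have := lt_le_trans pk i1; lra.
  suff : (simage G D `&` D) k by rewrite GD.
  split; last exact: KD.
  exists v => //.
  apply: (oscG v k (fun i => (ps (s i)).1) (fun i => (ps (s i)).2)) => //.
  + by move=> i; have [] := hps (s i).
  + by move=> i; have [] := hps (s i).
  + exact: enorm_cvg_inv.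
  + apply: enorm_cvg => e /(natSinv_lt)[N hN]; exists N => i Ni.
    by have [_ _ h] := hps (s i); apply: lt_trans h (hN _ (leq_trans Ni (si i))).
- by exists d => // k y Kk; exact: hd.
Qed.

Lemma jump_set_far : exists2 d, 0 < d &
  forall z v, simage G K z -> D v -> ~ edist v z < d.
Proof.
have [||d d0 hd] := seq_compact_uniform (simage G K) (fun z d => forall v,
  D v -> ~ edist v z < d) jump_image_seq_compact.
- by move=> k d d' d'0 dd hk v /hk h vk; apply: h; exact: lt_le_trans vk dd.
- move=> z [u Ku Gu]; have nDz : ~ D z.
    move=> Dz; suff : (simage G D `&` D) z by rewrite GD.
    by split => //; exists u => //; exact: KD.
  have [d d0 hd] := closed_eball D z clD nDz.
  exists (d / 2) => [|z' _ zz v Dv vz]; first lra.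
  by apply: (hd v) => //; have := edist_triangle z' v z; lra.
- by exists d => // z v Gz; exact: hd.
Qed.

End JumpMap.

(** * From closeness up to a jump to graphical closeness *)

Section GraphicalCloseness.
Context {R : realType} {n : nat}.
Variables (C D : set 'rV[R]_n) (F G : setmap R n).
Hypotheses (clC : closed C) (clD : closed D).
Hypotheses (oscF : osc_rel F C) (bddF : locbdd_rel F C).
Hypotheses (domF : C `<=` dom F) (cvxF : forall x, C x -> hconvex_set (F x)).
Hypotheses (oscG : osc_rel G D) (bddG : locbdd_rel G D) (domG : D `<=` dom G).
Hypotheses (GD : simage G D `&` D = set0).
Hypotheses (svG : single_valued G) (propG : proper_map G).
Hypothesis FT : forall x, C x -> D x -> F x `&` tangent_cone C x = set0.
Hypothesis NFT : forall x, C x -> simage G D x ->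
  [set - v | v in F x] `&` tangent_cone C x = set0.
Variable K : set 'rV[R]_n.
Hypotheses (cK : seq_compact K) (KD : K `<=` D).

Lemma sol_displacement (e : R) : 0 < e ->
  exists tau w, [/\ 0 < tau, 0 < w & forall E phi a b c i u s,
    is_solution C F D G E phi -> E (a, i) -> E (b, i) -> b - a <= tau ->
    a <= c -> c <= b -> K u -> edist (phi c i) u < w -> a <= s -> s <= b ->
    edist (phi s i) (phi c i) <= e].
Proof.
move=> e0; have [r r0 hr] := locbdd_uniform C F clC bddF K cK.
pose m := Num.min e (r / 4).
have m0 : 0 < m by rewrite lt_min e0 divr_gt0.
have me : m <= e by rewrite ge_min lexx.
have mr : m <= r / 4 by rewrite ge_min lexx orbT.
(* Speed [r^-1] during a time [m * r] gives a displacement of at most [m <= r / 4]; from within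
   [r / 2] of [u] this does not leave the ball of radius [r] where the speed bound holds. *)
exists (m * r), (r / 2); split; [exact: mulr_gt0 | lra | ].
move=> E phi a b c i u s sol Ea Eb bat ac cb Ku cu as_ sb.
have [ba|ab] := leP b a.
  have -> : s = c by apply/eqP; rewrite eq_le; apply/andP; split; lra.
  by rewrite edistxx ltW.
have ri0 : 0 <= r^-1 by rewrite invr_ge0 ltW.
have le : r^-1 * (b - a) <= m by rewrite mulrC ler_pdivrMr.
apply: (le_trans _ me); apply: (le_trans _ le).
have ax := sol_arc C D F G E phi a b i clC sol Ea Eb ab.
apply: (arc_stay C F a b (phi ^~ i) u r r^-1 c ax ri0 _ _ _ s _).2.
- by move=> z y Cz zu Fy; exact: (hr u z).
- by rewrite ac.
- by rewrite /=; lra.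
- by rewrite as_.
Qed.

Lemma sol_jump_soon (e : R) : 0 < e ->
  exists2 w, 0 < w & forall E phi t j u z,
    is_solution C F D G E phi -> t_complete E -> E (t, j) -> K u -> G u z ->
    edist (phi t j) u < w ->
    exists t', [/\ t <= t', t' < t + e, E (t', j.+1) & edist (phi t' j.+1) z < e].
Proof.
move=> e0.
have [d d0 hd] := jump_unif_continuous D G oscG bddG domG svG K cK KD e e0.
have [|tau1 [w1 [tau10 w10 disp]]] := sol_displacement (d / 2); first lra.
pose tau := Num.min e tau1.
have tau0 : 0 < tau by rewrite lt_min e0.
have taue : tau <= e by rewrite ge_min lexx.
have tautau1 : tau <= tau1 by rewrite ge_min lexx orbT.
have [e1 e10 he1] := no_flow_from_uniform C F clC oscF bddF domF cvxF K tau cK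
  (fun k Kk Ck => FT k Ck (KD k Kk)) tau0.
pose w := Num.min w1 (Num.min e1 (d / 2)).
exists w => [|E phi t j u z sol tc Et Ku Gu xu]; first by rewrite !lt_min w10 e10 divr_gt0.
move: xu; rewrite !lt_min => /and3P[xw1 xe1 xd].
have tt : t < t + tau by lra.
have [Es|[t' [tt' t't Et' Et'1]]] := sol_jump_after C D F G clC oscF bddF
    domF cvxF FT E phi t (t + tau) j sol tc Et tt.
  have ax := sol_arc C D F G E phi _ _ _ clC sol Et Es tt.
  by exfalso; apply: (he1 u _ _ _ Ku ax) => //; lra.
have [Dt' Gt'] := sol_jump sol Et' Et'1.
exists t'; split => //; first lra.
apply: (hd u (phi t' j)) => //.
have h : edist (phi t' j) (phi t j) <= d / 2.
  by apply: (disp E phi t t' t j u t') => //; lra.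
by have := edist_triangle (phi t j) (phi t' j) u; lra.
Qed.

(** A jump to level [j] during the last [tau] would have put a point of [G(D)] close to [u], which
    [jump_image_far] excludes. *)
Lemma sol_no_recent_jump (e : R) : 0 < e ->
  exists tau w, [/\ 0 < tau, 0 < w & forall E phi t j u s,
    is_solution C F D G E phi -> E (t, j) -> K u -> edist (phi t j) u < w ->
    0 <= s -> t - tau <= s -> s <= t ->
    [/\ E (s, j), edist (phi s j) (phi t j) <= e & ~ simage G D (phi s j)]].
Proof.
move=> e0; have [d d0 hd] := jump_image_far D G clD oscG GD propG K cK KD.
pose m := Num.min e (d / 2).
have m0 : 0 < m by rewrite lt_min e0 divr_gt0.
have me : m <= e by rewrite ge_min lexx.
have md : m <= d / 2 by rewrite ge_min lexx orbT.
have [tau [w1 [tau0 w10 disp]]] := sol_displacement m m0.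
exists tau, (Num.min w1 (d / 2)); split => //; first by rewrite lt_min w10 divr_gt0.
move=> E phi t j u s sol Et Ku; rewrite lt_min => /andP[xw1 xd] s0 ts st.
have hE : hybrid_time_domain E by case: sol => -[].
have flow s' : E (s', j) -> t - tau <= s' -> s' <= t ->
    edist (phi s' j) (phi t j) <= m /\ ~ simage G D (phi s' j).
  move=> Es' ts' s't.
  have h : edist (phi s' j) (phi t j) <= m.
    by apply: (disp E phi s' t t j u s') => //; lra.
  split => // /(hd u _ Ku); apply.
  by have := edist_triangle (phi t j) (phi s' j) u; lra.
have Es : E (s, j).
  apply: contrapT => nEs.
  have [t' [i [ji st' t't Et' Et'1]]] := htd_jump_before E s t j hE Et s0 st nEs.
  have [Di Gi] := sol_jump sol Et' Et'1.
  rewrite -ji in Et'1 Gi.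
  have [|_] := flow t' Et'1 _ t't; first lra.
  by apply; exists (phi t' i).
have [h nG] := flow s Es ts st.
by split => //; lra.
Qed.

(** The time [s] lies strictly before the jump, inside a flow interval. The level is unique there,
    so closeness assumed at time [s] for some level is closeness for level [i]. *)
Lemma sol_recent_jump (tau e : R) : 0 < tau -> 0 < e ->
  exists2 w, 0 < w & forall E phi t j u z,
    is_solution C F D G E phi -> E (t, j) -> tau <= t -> K u -> G u z ->
    edist (phi t j) z < w ->
    exists s i x, [/\ t - tau < s < t, E (s, i), forall i', E (s, i') -> i' = i,
      D x & edist (phi s i) x < e].
Proof.
move=> tau0 e0.
have tau20 : 0 < tau / 2 by lra.
have GKD z : simage G K z -> simage G D z.
  by case=> u Ku Gu; exists u => //; exact: KD.
have [w w0 hw] := no_flow_to_uniform C F clC oscF bddF domF cvxF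
  (simage G K) (tau / 2) (jump_image_seq_compact D G oscG bddG domG svG K cK KD)
  (fun k Kk Ck => NFT k Ck (GKD k Kk)) tau20.
exists w => // E phi t j u z sol Et taut Ku Gu xz.
have hE : hybrid_time_domain E by case: sol => -[].
have nE : ~ E (t - tau / 2, j).
  move=> Es; have lt : t - tau / 2 < t by lra.
  have ax := sol_arc C D F G E phi _ _ _ clC sol Es Et lt.
  by apply: (hw z _ _ _ _ ax) => //; [exists u | lra].
have [||t' [i [ji st' t't Et' Et'1]]] :=
  htd_jump_before E (t - tau / 2) t j hE Et _ _ nE; [lra | lra | ].
have t'0 : 0 < t' by lra.
have [a at' Ea] := sol_flow_before_jump C D F G GD E phi t' i sol Et' Et'1 t'0.
have [_ acx _ _] := sol_arc C D F G E phi a t' i clC sol Ea Et' at'.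
have [d dp hd] := abs_cont_unif_continuous a t' _ acx e e0.
pose p := Num.max (Num.max a (t - tau)) (t' - d); pose s := (p + t') / 2.
have pt' : p < t' by rewrite !gt_max at' /=; apply/andP; split; lra.
have ap : a <= p by rewrite !le_max lexx.
have tp : t - tau <= p by rewrite !le_max lexx !orbT.
have dpp : t' - d <= p by rewrite !le_max lexx !orbT.
have [ps st''] : p < s /\ s < t' by rewrite /s; lra.
clearbody s; clearbody p.
exists s, i, (phi t' i); split.
- by apply/andP; split; lra.
- by apply: (htd_interval E a t' i s) => //; lra.
- move=> i' Es; apply: (sol_index_unique C D F G clC oscF bddF domF cvxF FT
    E phi a t' s i i') => //; lra.
- by have [] := sol_jump sol Et' Et'1.
- apply: (hd s t'); first by apply/andP; split; lra.
    by rewrite lexx andbT ltW.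
  by rewrite ltr_norml; apply/andP; split; lra.
Qed.

(** Nearness to [setA] with jump points confined to [K]. The factor 2 arises from two points within
    [w] of the same point. *)
Definition jump_close (w : R) (x y : 'rV[R]_n) : Prop :=
  edist x y < 2 * w \/
  exists u z, [/\ K u, G u z &
    (edist x u < w /\ edist y z < w) \/ (edist x z < w /\ edist y u < w)].

Lemma jump_close_sym w x y : jump_close w x y -> jump_close w y x.
Proof.
by case=> [xy|[u [z [Ku Gu h]]]]; [left; rewrite edistC | right; exists u, z; split; tauto].
Qed.

(* If [phi1] is near [G u] and [phi2] near [u], then [phi2] is about to jump and
   lands near [phi1].  If [phi1] is near [u] and [phi2] near [G u], then [phi2]
   has just jumped (or time has just started), while [phi1] has been near [u];
   as [G] need not be injective, the pre-jump position of [phi2] is controlled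
   by comparing both solutions right before that jump. *)
Lemma jump_close_graphical (e : R) : 0 < e ->
  exists tau w, [/\ 0 < tau, 0 < w & forall E1 phi1 E2 phi2 t j,
    is_solution C F D G E1 phi1 -> is_solution C F D G E2 phi2 ->
    t_complete E2 -> E1 (t, j) ->
    (forall s i, t - tau <= s -> s <= t -> E1 (s, i) ->
       exists i', E2 (s, i') /\ jump_close w (phi1 s i) (phi2 s i')) ->
    tau <= t \/ edist (phi1 0 0%N) (phi2 0 0%N) < w ->
    exists t' j', [/\ E2 (t', j'), `|t - t'| < e &
      edist (phi1 t j) (phi2 t' j') < e]].
Proof.
move=> e0.
have [d0 d00 hd0] := jump_image_far D G clD oscG GD propG K cK KD.
have [d1 d10 hd1] := jump_set_far D G clD oscG bddG domG GD svG K cK KD.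
(* The triangle inequalities below cost at most [3 * m], or [m] on top of [e / 2]. *)
pose m := Num.min e (Num.min d0 d1) / 4.
have m0 : 0 < m by rewrite divr_gt0 // !lt_min e0 d00 d10.
have [me md0 md1] : [/\ 4 * m <= e, 4 * m <= d0 & 4 * m <= d1].
  have -> : 4 * m = Num.min e (Num.min d0 d1) by rewrite /m mulrC divfK.
  by split; rewrite !ge_min lexx ?orbT.
have [|wA wA0 soon] := sol_jump_soon (e / 2); first lra.
have [tauB [wB [tauB0 wB0 norecent]]] := sol_no_recent_jump m m0.
pose tau := Num.min (e / 2) tauB.
have tau0 : 0 < tau by rewrite lt_min divr_gt0.
have taue : tau <= e / 2 by rewrite ge_min lexx.
have tauB' : tau <= tauB by rewrite ge_min lexx orbT.
have [wC wC0 recent] := sol_recent_jump tau m tau0 m0.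
pose w := Num.min m (Num.min wA (Num.min wB wC)).
have w0 : 0 < w by rewrite !lt_min m0 wA0 wB0.
have [wm wwA wwB wwC] : [/\ w <= m, w <= wA, w <= wB & w <= wC].
  by split; rewrite !ge_min lexx ?orbT.
clearbody m tau w.
exists tau, w; split => // E1 phi1 E2 phi2 t j sol1 sol2 tc2 E1t close init.
have ttau : t - tau <= t by lra.
have [j2 [E2t]] := close t j ttau (lexx t) E1t.
case=> [diag|[u [z [Ku Gu [[xu yz]|[xz yu]]]]]].
- by exists t, j2; split => //; [rewrite subrr normr0 | lra].
- have E1flow s : 0 <= s -> t - tau <= s -> s <= t ->
      [/\ E1 (s, j), edist (phi1 s j) (phi1 t j) <= m & ~ simage G D (phi1 s j)].
    move=> s0 ts st; apply: (norecent E1 phi1 t j u s) => //; last by lra.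
    exact: lt_le_trans xu wwB.
  have t0 := sol_time_ge0 sol1 E1t.
  have [taut|ttau'] := leP tau t; last first.
    (* Here the window reaches below time 0. The first solution has flowed since time 0 without any
       jump, so the initial values can be compared instead. *)
    have [||E10 h0 nG] := E1flow 0 (lexx 0); [lra | by [] | ].
    have j0 : j = 0%N.
      case: j => [//|i] in E1t E10 h0 nG xu E1flow *; exfalso; apply: nG.
      have E10' : E1 (0, i) by apply: htd_zero E10; case: sol1 => -[].
      by have [D0 G0] := sol_jump sol1 E10' E10; exists (phi1 0 i).
    case: init => [|init]; first by lra.
    exists 0, 0%N; split; first by case: sol2 => -[].
      by rewrite subr0 ger0_norm //; lra.
    have := edist_triangle (phi1 0 j) (phi1 t j) (phi2 0 0%N).
    have init' : edist (phi1 0 j) (phi2 0 0%N) < w by rewrite j0.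
    by rewrite (edistC (phi1 t j) (phi1 0 j)); lra.
  have [s [i [x [/andP[ts st] E2s iuniq Dx h2]]]] :=
    recent E2 phi2 t j2 u z sol2 E2t taut Ku Gu (lt_le_trans yz wwC).
  have [|||E1s h1 _] := E1flow s; [lra | lra | lra | ].
  have [i' [E2s' +]] := close s j (ltW ts) (ltW st) E1s.
  rewrite (iuniq i' E2s').
  (* Only the diagonal case survives: [phi2 s i] is near [x] in [D], hence far from [G(K)], and
     [phi1 s j] is near [u] in [K], hence far from [G(D)]. *)
  case=> [diag|[u' [z' [Ku' Gu' [[xu' yz']|[xz' yu']]]]]].
  + exists s, i; split => //; first by rewrite ltr_norml; apply/andP; split; lra.
    have := edist_triangle (phi1 s j) (phi1 t j) (phi2 s i).
    by rewrite (edistC (phi1 t j) (phi1 s j)); lra.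
  + exfalso; apply: (hd1 z' x) => //; first by exists u'.
    have := edist_triangle (phi2 s i) x z'.
    by rewrite (edistC x (phi2 s i)); lra.
  + exfalso; apply: (hd0 u z') => //; first by exists u' => //; exact: KD.
    have := edist_triangle (phi1 s j) z' u.
    have := edist_triangle (phi1 t j) (phi1 s j) u.
    by rewrite (edistC z' (phi1 s j)); lra.
- have [t' [tt' t't E2t' h]] :=
    soon E2 phi2 t j2 u z sol2 tc2 E2t Ku Gu (lt_le_trans yu wwA).
  exists t', j2.+1; split => //; first by rewrite ltr_norml; apply/andP; split; lra.
  have := edist_triangle z (phi1 t j) (phi2 t' j2.+1).
  by rewrite (edistC z (phi2 t' j2.+1)); lra.
Qed.

End GraphicalCloseness.

(** * Comparison of [rhoA] with the Euclidean distance *)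

Section RhoDistance.
Context {R : realType} {n : nat}.
Variables (C D : set 'rV[R]_n) (G : setmap R n).

Lemma enorm_le_enorm2 (a b : 'rV[R]_n) :
  enorm a <= enorm2 a b /\ enorm b <= enorm2 a b.
Proof.
have h (x : 'rV[R]_n) : enorm x = Num.sqrt (enorm x ^+ 2).
  by rewrite sqrtr_sqr ger0_norm // enorm_ge0.
by split; rewrite h ler_wsqrtr // ?lerDl ?lerDr sqr_ge0.
Qed.

(** The point [x0] makes [setA] nonempty; the infimum of an empty set is 0 by convention and would
    carry no information. *)
Lemma rhoA_lt (x0 x y : 'rV[R]_n) (e : R) : (C `|` D) x0 -> rhoA C D G x y < e ->
  exists p, [/\ setA C D G p, edist x p.1 < e & edist y p.2 < e].
Proof.
move=> Sx0 /inf_lt [|_ [p Ap <-] lt].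
  by exists (enorm2 (x - x0) (y - x0)), (x0, x0) => //; split; [left | split; [left | left]].
have [h1 h2] := enorm_le_enorm2 (x - p.1) (y - p.2).
by exists p; split => //; [exact: le_lt_trans h1 lt | exact: le_lt_trans h2 lt].
Qed.

Lemma rhoA_le_edist (x y : 'rV[R]_n) : (C `|` D) x -> rhoA C D G x y <= edist x y.
Proof.
move=> Sx; apply: ge_inf; first by exists 0 => _ [p _ <-]; exact: sqrtr_ge0.
exists (x, x); first by split; [left | split; [left | left]].
rewrite /= /enorm2 subrr enorm0 expr0n add0r sqrtr_sqr ger0_norm ?enorm_ge0 //.
exact: edistC.
Qed.

End RhoDistance.

Theorem theorem2 (R : realType) (n : nat)
  (C D : set 'rV[R]_n) (F G : setmap R n)
  (Es : set (R * nat)) (phis : R -> nat -> 'rV[R]_n) :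
  (* (A1) *)
  closed C -> closed D ->
  (* (A2) *)
  osc_rel F C -> locbdd_rel F C -> C `<=` dom F ->
  (forall x, C x -> hconvex_set (F x)) ->
  (* (A3) *)
  osc_rel G D -> locbdd_rel G D -> D `<=` dom G ->
  (* phi* is a t-complete solution *)
  is_solution C F D G Es phis -> t_complete Es ->
  (* (i) *)
  simage G D `&` D = set0 -> simage G D `<=` C ->
  single_valued G -> proper_map G ->
  (* (ii) *)
  (forall x, C x -> D x -> F x `&` tangent_cone C x = set0) ->
  (* (iii) *)
  (forall x, C x -> simage G D x ->
     [set - v | v in F x] `&` tangent_cone C x = set0) ->
  (* (iv) *)
  ebounded_set D \/ bounded_sol Es phis ->
  (stable_rho C F D G Es phis -> stable_graph C F D G Es phis) /\
  (as_stable_rho C F D G Es phis -> as_stable_graph C F D G Es phis).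
Proof.
move=> clC clD oscF bddF domF cvxF oscG bddG domG sols tcs GD _ svG propG FT NFT bdd.
have S0 : (C `|` D) (phis 0 0%N) by case: sols.
have [M rho_close] : exists M : R, forall w t j y, 0 < w -> Es (t, j) ->
    rhoA C D G (phis t j) y < Num.min w 1 ->
    jump_close G (D `&` [set x | enorm x <= M]) w (phis t j) y.
  (* Hypothesis (iv) enters here. If [phis] is bounded, so is any [u] near it, and a [u] whose image
     is near it is bounded by properness. The cap 1 in [Num.min w 1] fixes how near. *)
  have [M hM] : exists M : R, forall t j u z, Es (t, j) -> D u -> G u z ->
      edist (phis t j) u < 1 \/ edist (phis t j) z < 1 -> enorm u <= M.
    case: bdd => [[M hM]|[M hM]]; first by exists M => t j u z _ Du _ _; exact: hM.
    have [M' hM'] := proper_coercive G propG (M + 1).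
    have near t j v : Es (t, j) -> edist (phis t j) v < 1 -> enorm v <= M + 1.
      move=> Et; have := hM t j Et; have := enorm_le_dist v (phis t j).
      by rewrite (edistC v); lra.
    exists (Num.max (M + 1) M') => t j u z Et Du Gu; rewrite le_max.
    case=> /(near t j _ Et) h; first by rewrite h.
    by rewrite (hM' u z Gu h) orbT.
  exists M => w t j y w0 Et /(rhoA_lt C D G _ _ _ _ S0) [[u v] /=].
  rewrite !lt_min => -[[_ [_ Auv]] /andP[xuw xu1] /andP[yvw yv1]].
  case: Auv => /= [uv|Auv].
    left; apply: le_lt_trans (edist_triangle u _ _) _.
    by rewrite (edistC u) {2}uv; lra.
  right; case: Auv => [[Dv Gv]|[Du Gu]].
    exists v, u; split => //; last by right.
    by split => //; apply: (hM t j v u) => //; right.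
  exists u, v; split => //; last by left.
  by split => //; apply: (hM t j u v) => //; left.
pose K := D `&` [set x | enorm x <= M].
have cK : seq_compact K by exact: closed_seq_compact.
have KD : K `<=` D by move=> x [].
(* One statement serves both conclusions: [T + tau <= T'] leaves room for the window, while [T = 0]
   with close initial values gives stability from time 0 on. *)
have graphical (e : R) : 0 < e -> exists tau w, [/\ 0 < tau, 0 < w &
    forall E phi T, is_solution C F D G E phi -> 0 <= T ->
      (forall t j, Es (t, j) -> T <= t -> exists j',
        E (t, j') /\ rhoA C D G (phis t j) (phi t j') < Num.min w 1) ->
      (forall t j', E (t, j') -> T <= t -> exists j,
        Es (t, j) /\ rhoA C D G (phis t j) (phi t j') < Num.min w 1) ->
      forall T', T + tau <= T' \/ T = 0 /\ edist (phis 0 0%N) (phi 0 0%N) < w ->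
      (forall t j, Es (t, j) -> T' <= t -> exists t' j',
         E (t', j') /\ `|t - t'| < e /\ enorm (phis t j - phi t' j') < e) /\
      (forall t' j', E (t', j') -> T' <= t' -> exists t j,
         Es (t, j) /\ `|t - t'| < e /\ enorm (phis t j - phi t' j') < e)].
  move=> e0; have [tau [w [tau0 w0 main]]] :=
    jump_close_graphical C D F G clC clD oscF bddF domF cvxF oscG bddG domG GD
      svG propG FT NFT K cK KD e e0.
  exists tau, w; split => // E phi T sol T0 ha hb T' hT'.
  (* [phi] inherits t-completeness, since closeness supplies a point of [E] at every late time of
     [phis]. *)
  have tc : t_complete E.
    move=> X; have [t [j [Et XT]]] := tcs (Num.max X T).
    move: XT; rewrite ge_max => /andP[Xt Tt].
    by have [j' [Et' _]] := ha t j Et Tt; exists t, j'.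
  have late s t : T' <= t -> t - tau <= s -> 0 <= s -> T <= s.
    by case: hT' => [|[-> _]]; lra.
  have start t : T' <= t -> tau <= t \/ edist (phis 0 0%N) (phi 0 0%N) < w.
    by case: hT' => [h|[_ h]] tT'; [left; lra | right].
  split => [t j Et|t j Et] T't.
    have [||t' [j' [? ? ?]]] := main Es phis E phi t j sols sol tc Et; last by exists t', j'.
      move=> s i ts st Ei.
      have [i' [Ei' rho]] := ha s i Ei (late s t T't ts (sol_time_ge0 sols Ei)).
      by exists i'; split => //; exact: rho_close.
    exact: start.
  have [||t' [j' [? ? ?]]] := main E phi Es phis t j sol sols tcs Et.
  - move=> s i ts st Ei.
    have [i' [Ei' rho]] := hb s i Ei (late s t T't ts (sol_time_ge0 sol Ei)).
    by exists i'; split => //; apply: jump_close_sym; exact: rho_close.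
  - by rewrite (edistC (phi _ _)); exact: start.
  - exists t', j'; split => //; split; first by rewrite distrC.
    by rewrite -/(edist (phis t' j') (phi t j)) edistC.
have w10 (w : R) : 0 < w -> 0 < Num.min w 1 by move=> w0; rewrite lt_min w0 ltr01.
have rho_graph : stable_rho C F D G Es phis -> stable_graph C F D G Es phis.
  move=> st e e0; have [tau [w [tau0 w0 main]]] := graphical e e0.
  have [d d0 hd] := st _ (w10 w w0).
  exists (Num.min d w) => [|E phi msol]; first by rewrite lt_min d0.
  rewrite lt_min => /andP[hdd hw]; have sol : is_solution C F D G E phi by case: msol.
  have [ha hb] := hd E phi msol (le_lt_trans (rhoA_le_edist C D G _ _ S0) hdd).
  have [hc hd'] := main E phi 0 sol (lexx 0) (fun t j Et _ => ha t j Et)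
    (fun t j Et _ => hb t j Et) 0 (or_intror (conj erefl hw)).
  split=> t j Et; first exact: hc Et (sol_time_ge0 sols Et).
  exact: hd' Et (sol_time_ge0 sol Et).
split => // -[st [rw rw0 hrw]]; split; first exact: rho_graph.
exists rw => // e e0 E phi msol hd.
have [tau [w [tau0 w0 main]]] := graphical e e0.
have sol : is_solution C F D G E phi by case: msol.
have [T [T0 [ha hb]]] := hrw _ (w10 w w0) E phi msol
  (le_lt_trans (rhoA_le_edist C D G _ _ S0) hd).
exists (T + tau); split; first by lra.
exact: main sol T0 ha hb (T + tau) (or_introl (lexx _)).
Qed.
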